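(* Let $0\le \alpha<1$. If $f(z)=z+\sum_{n=2}^{\infty}a_{n}z^{n}$ belongs to $S^{*}(\alpha)$, the class of starlike functions of order $\alpha$ in $D=\{z\in\mathbb{C}:|z|<1\}$, then the second Hankel determinant $H_{2}(2)=|a_{2}a_{4}-a_{3}^{2}|$ satisfies $$H_{2}(2)\le (1-\alpha)^{2}.$$ The inequality is sharp, i.e. for each $\alpha\in[0,1)$ there exists $f\in S^{*}(\alpha)$ for which equality holds.
   Context: Let $D=\{z\in\mathbb{C}:|z|<1\}$. For $0\le\alpha<1$, a function $f$ analytic in $D$ with power series $f(z)=z+\sum_{n=2}^{\infty}a_{n}z^{n}$ (complex coefficients $a_n$) is called starlike of order $\alpha$ in $D$ if $\operatorname{Re}\dfrac{zf'(z)}{f(z)}>\alpha$ for all $z\in D$, where the quotient is understood to take the value $1$ (its limit) at $z=0$. The class of all such functions is denoted $S^{*}(\alpha)$. The second Hankel determinant of $f$ is $H_{2}(2)=|a_{2}a_{4}-a_{3}^{2}|$, where the bars denote the modulus of a complex number. *)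

(* Defs.v *)
(* Stdlib + Coquelicot: complex numbers are Coquelicot's [C]. *)
From Stdlib Require Import Reals.
From Coquelicot Require Import Coquelicot.

Open Scope R_scope.

Definition in_disk (z : C) : Prop := Cmod z < 1.

(* Complex differentiability: the field over which the derivative is taken is
   [C_AbsRing]. Functions are total on [C]; values outside the disk are
   irrelevant. *)
Definition analytic_in_disk (f : C -> C) : Prop :=
  forall z : C, in_disk z -> @ex_derive C_AbsRing C_NormedModule f z.

(* f(z) = z + a_2 z^2 + a_3 z^3 + ... for |z| < 1. *)
Definition normalized_expansion (f : C -> C) (a : nat -> C) : Prop :=
  a 0%nat = RtoC 0 /\ a 1%nat = RtoC 1 /\
  forall z : C, in_disk z -> @is_pseries C_AbsRing C_NormedModule a z (f z).

(* z f'(z) / f(z), extended by its limit 1 at the origin. *)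
Definition starlike_quotient (f : C -> C) (z : C) : C :=
  if Ceq_dec z (RtoC 0) then RtoC 1 else Cdiv (Cmult z (C_derive f z)) (f z).

(* Division on [C] is total, so the condition that the quotient be defined
   throughout the punctured disk is written out: f z <> 0 for z <> 0. *)
Definition starlike_of_order (alpha : R) (f : C -> C) : Prop :=
  analytic_in_disk f /\
  (exists a : nat -> C, normalized_expansion f a) /\
  (forall z : C, in_disk z -> z <> RtoC 0 -> f z <> RtoC 0) /\
  (forall z : C, in_disk z -> alpha < Re (starlike_quotient f z)).

Definition hankel22 (a : nat -> C) : R :=
  Cmod (Cminus (Cmult (a 2%nat) (a 4%nat)) (Cmult (a 3%nat) (a 3%nat))).

(* Main.v *)
Require Import Defs.
From Stdlib Require Import Reals Lra Lia ClassicalEpsilon.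
From Coquelicot Require Import Coquelicot.

(** Put beta = 1 - alpha. The condition Re (z f'/f) > alpha says
    |z f' - f| < |z f' + (1 - 2 alpha) f|, so the quotient of these two power
    series is z w(z), w = w1 + w2 z + w3 z^2 + ..., and Schwarz's lemma gives
    |w| <= 1. Two further steps of Schur's algorithm give, with x = |w1|,
    |w2| <= 1 - x^2 and |w3| <= 1 - x^2 - |w2|^2 / (1 + x). Comparing
    coefficients,
      a2 a4 - a3^2
        = beta^2 (4/3 w1 w3 + 2/3 w1^2 w2 - w2^2 + (1 - 4 beta^2)/3 w1^4),
    and the triangle inequality suffices: the resulting bound increases with
    |w2| and equals 1 at |w2| = 1 - x^2. Equality holds for
    f(z) = z (1 - z^2)^(-beta).

    All functions met on the way are quotients A/B of convergent power series.
    Since power series are stable under division by z - z0, such a quotient has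
    Taylor expansions at every point of the disk, which is all that the maximum
    principle requires. *)

(** * Power series in the unit disk *)

Definition expands (a : nat -> C) (F : C -> C) : Prop :=
  forall z : C, in_disk z -> @is_pseries C_AbsRing C_NormedModule a z (F z).

Lemma pow_n_Cpow (z : C) (n : nat) : @pow_n C_Ring z n = (z ^ n)%C.
Proof.
  induction n as [|n IH]; [reflexivity|].
  change (Cmult z (@pow_n C_Ring z n) = Cmult z (z ^ n)%C). now rewrite IH.
Qed.

Lemma is_pseries_Cunique (a : nat -> C) (z l l' : C) :
  @is_pseries C_AbsRing C_NormedModule a z l ->
  @is_pseries C_AbsRing C_NormedModule a z l' -> l = l'.
Proof.
  intros H H'.
  exact (@filterlim_locally_unique nat C_AbsRing C_NormedModule eventually _ _ l l' H H').
Qed.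

(** Each term is a difference of two consecutive partial sums, and convergent partial sums are
    bounded. *)
Lemma is_pseries_bounded (a : nat -> C) (z l : C) :
  @is_pseries C_AbsRing C_NormedModule a z l ->
  exists M, forall n, Cmod (a n) * Cmod z ^ n <= M.
Proof.
  intros H.
  set (t := fun k => Cmult (@pow_n C_Ring z k) (a k)).
  destruct (@filterlim_bounded C_AbsRing C_NormedModule (sum_n t)) as [M HC].
  { exists l. exact H. }
  change (forall n, Cmod (sum_n t n) <= M) in HC.
  exists (M + M). intros n.
  assert (E : Cmod (a n) * Cmod z ^ n = Cmod (t n)).
  { unfold t. rewrite pow_n_Cpow, Cmod_mult, Cmod_pow. ring. }
  rewrite E. destruct n as [|n].
  - specialize (HC 0%nat). rewrite sum_O in HC.
    pose proof (Cmod_ge_0 (t 0%nat)). lra.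
  - pose proof (HC (S n)) as H1. pose proof (HC n) as H2.
    rewrite sum_Sn in H1.
    change (Cmod (sum_n t n + t (S n))%C <= M) in H1.
    replace (t (S n)) with ((sum_n t n + t (S n)) + - sum_n t n)%C by ring.
    eapply Rle_trans; [apply Cmod_triangle|]. rewrite Cmod_opp. lra.
Qed.

(** Comparison with the geometric series of ratio [Cmod z / rho]. The explicit bound on the sum
    serves later to control tail sums and to bound power series locally. *)
Lemma is_pseries_geom_bound (a : nat -> C) (rho M : R) (z : C) :
  (forall n, Cmod (a n) * rho ^ n <= M) -> Cmod z < rho ->
  exists l, @is_pseries C_AbsRing C_NormedModule a z l /\
            Cmod l <= M * / (1 - Cmod z / rho).
Proof.
  intros HM Hz.
  pose proof (Cmod_ge_0 z) as Hz0.
  assert (Hrho : 0 < rho) by lra.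
  set (q := Cmod z / rho).
  assert (Hq : 0 <= q < 1).
  { unfold q; split. apply Rdiv_le_0_compat; lra.
    apply Rlt_div_l; lra. }
  assert (Hs : is_series (fun n => M * q ^ n) (M * / (1 - q))).
  { apply (is_series_scal M (fun n => q ^ n)). apply is_series_geom.
    rewrite Rabs_pos_eq; lra. }
  assert (Hb : forall n, norm (@scal C_AbsRing C_NormedModule (@pow_n C_Ring z n) (a n)) <= M * q ^ n).
  { intros n. 
    change (Cmod (Cmult (@pow_n C_Ring z n) (a n)) <= M * q ^ n).
    rewrite pow_n_Cpow, Cmod_mult, Cmod_pow.
    replace (Cmod z ^ n) with (rho ^ n * q ^ n).
    2:{ rewrite <- Rpow_mult_distr. f_equal. unfold q. field. lra. }
    specialize (HM n).
    assert (0 <= q ^ n) by (apply pow_le; lra). nra. }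
  destruct (@ex_series_le C_AbsRing C_CompleteNormedModule
     (fun n => scal (@pow_n C_Ring z n) (a n)) (fun n => M * q ^ n)) as [l Hl].
  { exact Hb. }
  { eexists; exact Hs. }
  exists l. split; [exact Hl|].
  assert (L1 : is_lim_seq (fun n => @norm C_AbsRing C_NormedModule
      (sum_n (fun k => @scal C_AbsRing C_NormedModule (@pow_n C_Ring z k) (a k)) n)) (Cmod l)).
  { exact (filterlim_comp _ _ _ _ _ _ _ _ Hl (@filterlim_norm C_AbsRing C_NormedModule l)). }
  refine (is_lim_seq_le _ _ (Cmod l) (M * / (1 - q)) _ L1 Hs).
  intros n. eapply Rle_trans.
  { apply (@norm_sum_n_m C_AbsRing C_NormedModule). }
  apply sum_n_m_le. exact Hb.
Qed.

Lemma expands_bounded (a : nat -> C) (F : C -> C) (rho : R) :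
  expands a F -> 0 <= rho < 1 ->
  exists M, 0 <= M /\ forall n, Cmod (a n) * rho ^ n <= M.
Proof.
  intros HF Hr.
  destruct (is_pseries_bounded a (RtoC rho) (F (RtoC rho))) as [M HM].
  { apply HF. unfold in_disk. rewrite Cmod_R, Rabs_pos_eq; lra. }
  rewrite Cmod_R, Rabs_pos_eq in HM by lra.
  exists M; split; [|exact HM].
  specialize (HM 0%nat). pose proof (Cmod_ge_0 (a 0%nat)). cbn in HM. lra.
Qed.

(** Converse of [expands_bounded]: growth of the coefficients alone decides convergence in the disk,
    so new power series can be built from coefficient estimates. *)
Lemma expands_exists (a : nat -> C) :
  (forall rho, 0 < rho < 1 -> exists M, forall n, Cmod (a n) * rho ^ n <= M) ->
  exists F, expands a F.
Proof.
  intros H.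
  assert (K : forall z, exists l, in_disk z -> @is_pseries C_AbsRing C_NormedModule a z l).
  { intros z. destruct (Rlt_dec (Cmod z) 1) as [Hz|Hz].
    - pose proof (Cmod_ge_0 z).
      destruct (H ((Cmod z + 1) / 2)) as [M HM]; [lra|].
      destruct (is_pseries_geom_bound a _ M z HM) as [l [Hl _]]; [lra|].
      now exists l.
    (* Outside the disk any value will do. *)
    - exists z. intros Hz'. contradiction. }
  exists (fun z => proj1_sig (constructive_indefinite_description _ (K z))).
  intros z Hz. destruct (constructive_indefinite_description _ (K z)) as [l Hl]. now apply Hl.
Qed.

Lemma expands_ext (a b : nat -> C) (F G : C -> C) :
  (forall n, a n = b n) -> (forall z, in_disk z -> F z = G z) ->
  expands a F -> expands b G.
Proof.
  intros Hab HFG HF z Hz. rewrite <- HFG by exact Hz.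
  apply (is_pseries_ext a b); auto.
Qed.

Lemma expands_unique (a : nat -> C) (F G : C -> C) (z : C) :
  expands a F -> expands a G -> in_disk z -> F z = G z.
Proof. intros HF HG Hz. eapply is_pseries_Cunique; eauto. Qed.

Lemma expands_plus (a b : nat -> C) (F G : C -> C) :
  expands a F -> expands b G ->
  expands (fun n => a n + b n)%C (fun z => F z + G z)%C.
Proof.
  intros HF HG z Hz. exact (is_pseries_plus _ _ _ _ _ (HF z Hz) (HG z Hz)).
Qed.

Lemma expands_scal (c : C) (a : nat -> C) (F : C -> C) :
  expands a F -> expands (fun n => c * a n)%C (fun z => c * F z)%C.
Proof.
  intros HF z Hz. refine (is_pseries_scal c a z _ _ (HF z Hz)). apply Cmult_comm.
Qed.

Lemma expands_shift (a : nat -> C) (F : C -> C) :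
  expands a F ->
  expands (fun n => match n with O => RtoC 0 | S m => a m end) (fun z => z * F z)%C.
Proof.
  intros HF z Hz.
  refine (is_pseries_ext _ _ _ _ _ (is_pseries_incr_1 a z _ (HF z Hz))).
  now intros [|n].
Qed.

Lemma expands_at_0 (a : nat -> C) (F : C -> C) : expands a F -> F (RtoC 0) = a 0%nat.
Proof.
  intros HF. eapply is_pseries_Cunique.
  - apply HF. unfold in_disk. rewrite Cmod_0. lra.
  - exact (@is_pseries_0 C_AbsRing C_NormedModule a).
Qed.

Lemma expands_const (c : C) :
  expands (fun n => match n with O => c | S _ => RtoC 0 end) (fun _ => c).
Proof.
  intros z _.
  apply (filterlim_ext (fun _ => c)); [|apply filterlim_const].
  intros n. induction n as [|n IH].
  - rewrite sum_O. change (c = 1 * c)%C. ring.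
  - rewrite sum_Sn, <- IH.
    change (c = c + @pow_n C_Ring z (S n) * 0)%C. ring.
Qed.

Lemma expands_decr (a : nat -> C) (F : C -> C) :
  expands a F ->
  exists G, expands (fun n => a (S n)) G /\
            forall z, in_disk z -> F z = (a 0%nat + z * G z)%C.
Proof.
  intros HF.
  destruct (expands_exists (fun n => a (S n))) as [G HG].
  { intros rho Hr.
    destruct (expands_bounded a F rho HF) as [M [HM0 HM]]; [lra|].
    exists (M / rho). intros n. apply -> Rle_div_r; [|lra].
    replace (Cmod (a (S n)) * rho ^ n * rho) with (Cmod (a (S n)) * rho ^ S n)
      by (cbn; ring).
    apply HM. }
  exists G. split; [exact HG|].
  intros z Hz.
  apply (expands_unique a F (fun z => a 0%nat + z * G z)%C z HF); [|exact Hz].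
  refine (expands_ext _ _ _ _ _ _ (expands_plus _ _ _ _ (expands_const (a 0%nat)) (expands_shift _ _ HG))).
  - intros [|n]; cbn beta iota; ring.
  - reflexivity.
Qed.

(** [T n] sums the series with its first [n] coefficients dropped; the values [T (S n) z0] will be
    the coefficients of the quotient by z - z0. *)
Lemma expands_tails (a : nat -> C) (F : C -> C) :
  expands a F ->
  exists T : nat -> C -> C,
    (forall n, expands (fun j => a (n + j)%nat) (T n)) /\
    (forall z, in_disk z -> T 0%nat z = F z) /\
    (forall n z, in_disk z -> T n z = (a n + z * T (S n) z)%C).
Proof.
  intros HF.
  assert (K : forall n, exists G, expands (fun j => a (n + j)%nat) G).
  { intros n. induction n as [|n [G HG]].
    - now exists F.
    - destruct (expands_decr _ _ HG) as [G' [HG' _]]. exists G'.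
      refine (expands_ext _ _ _ _ _ (fun z _ => eq_refl) HG').
      intros j. f_equal. lia. }
  exists (fun n => proj1_sig (constructive_indefinite_description _ (K n))).
  assert (HT : forall n, expands (fun j => a (n + j)%nat)
     (proj1_sig (constructive_indefinite_description _ (K n)))).
  { intros n. apply proj2_sig. }
  split; [exact HT|]. split.
  - intros z Hz. exact (expands_unique _ _ _ _ (HT 0%nat) HF Hz).
  - intros n z Hz. destruct (expands_decr _ _ (HT n)) as [G' [HG' E]].
    rewrite E by exact Hz. rewrite PeanoNat.Nat.add_0_r. do 2 f_equal.
    apply (expands_unique _ _ _ _ HG'); [|exact Hz].
    refine (expands_ext _ _ _ _ _ (fun z _ => eq_refl) (HT (S n))).
    intros j. f_equal. lia.
Qed.

(* Synthetic division by z - z0: b_n is the tail sum of a_(n+1+j) z0^j. *)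
Lemma expands_factor (a : nat -> C) (F : C -> C) (z0 : C) :
  expands a F -> in_disk z0 ->
  exists b G, expands b G /\
    (forall n, b n = a (S n) + z0 * b (S n))%C /\
    (forall z, in_disk z -> F z = F z0 + (z - z0) * G z)%C.
Proof.
  intros HF Hz0.
  destruct (expands_tails a F HF) as [T [HT [HT0 HTS]]].
  pose proof (Cmod_ge_0 z0) as Hz0'. unfold in_disk in Hz0.
  set (b := fun n => T (S n) z0).
  assert (Hb : forall n, b n = (a (S n) + z0 * b (S n))%C).
  { intros n. unfold b. now apply HTS. }
  destruct (expands_exists b) as [G HG].
  { intros rho Hr.
    (* This radius is at least [rho], where the growth of [b] is tested, and exceeds |z0|, so that
       the tails at [z0] are dominated by a geometric series. *)
    set (r := Rmax rho ((1 + Cmod z0) / 2)).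
    assert (Hr1 : rho <= r) by apply Rmax_l.
    assert (Hr2 : (1 + Cmod z0) / 2 <= r) by apply Rmax_r.
    assert (Hr3 : r < 1) by (unfold r; apply Rmax_lub_lt; lra).
    destruct (expands_bounded a F r HF) as [M [HM0 HM]]; [lra|].
    exists (M * / (1 - Cmod z0 / r) / r).
    intros n.
    assert (HrS : 0 < r ^ S n) by (apply pow_lt; lra).
    destruct (is_pseries_geom_bound (fun j => a (S n + j)%nat) r (M / r ^ S n) z0) as [l [Hl Hbd]].
    { intros j. apply -> Rle_div_r; [|exact HrS].
      rewrite Rmult_assoc, <- pow_add.
      replace (j + S n)%nat with (S n + j)%nat by lia. apply HM. }
    { lra. }
    rewrite (is_pseries_Cunique _ _ _ _ Hl (HT (S n) z0 Hz0)) in Hbd.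
    fold (b n) in Hbd.
    assert (Hp : rho ^ n <= r ^ n) by (apply pow_incr; lra).
    pose proof (Cmod_ge_0 (b n)).
    apply Rle_trans with (Cmod (b n) * r ^ n); [apply Rmult_le_compat_l; lra|].
    assert (Hrn : 0 < r ^ n) by (apply pow_lt; lra).
    apply Rle_trans with (M / r ^ S n * / (1 - Cmod z0 / r) * r ^ n).
    { apply Rmult_le_compat_r; lra. }
    right. cbn [pow]. field. repeat split; lra. }
  exists b, G. split; [exact HG|]. split; [exact Hb|].
  intros z Hz.
  (* The factorization follows by comparing coefficients of (z - z0) G and F - F(z0), through the
     recursion [Hb]. *)
  pose proof (expands_plus _ _ _ _ (expands_shift _ _ HG) (expands_scal (- z0)%C _ _ HG)) as H1.
  pose proof (expands_plus _ _ _ _ HF (expands_const (- F z0)%C)) as H2.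
  assert (E : (F z + - F z0 = z * G z + - z0 * G z)%C).
  { refine (expands_unique _ (fun z => F z + - F z0)%C (fun z => z * G z + - z0 * G z)%C z H2 _ Hz).
    refine (expands_ext _ _ _ _ _ (fun z _ => eq_refl) H1).
    intros [|n]; cbn beta iota.
    - rewrite <- (HT0 z0 Hz0), (HTS 0%nat z0 Hz0). fold (b 0%nat). ring.
    - rewrite (Hb n). ring. }
  replace (F z) with (F z + - F z0 + F z0)%C by ring. rewrite E. ring.
Qed.

Lemma expands_locally_bounded (a : nat -> C) (F : C -> C) (z0 : C) :
  expands a F -> in_disk z0 ->
  exists K d, 0 <= K /\ 0 < d /\
    forall z, Cmod (z - z0) < d -> in_disk z /\ Cmod (F z) <= K.
Proof.
  intros HF Hz0. unfold in_disk in *.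
  pose proof (Cmod_ge_0 z0).
  set (d := (1 - Cmod z0) / 3).
  (* The neighbourhood lies inside radius [r1], while the coefficients are estimated at the larger
     radius [r2 < 1]; the gap gives a uniform geometric ratio [r1 / r2]. *)
  set (r1 := Cmod z0 + d). set (r2 := Cmod z0 + 2 * d).
  assert (0 < d) by (unfold d; lra).
  assert (Hr2 : r2 < 1) by (unfold r2, d; lra).
  assert (H12 : r1 < r2) by (unfold r1, r2; lra).
  destruct (expands_bounded a F r2 HF) as [M [HM0 HM]]; [unfold r2 in *; lra|].
  exists (M * / (1 - r1 / r2)), d.
  assert (Hq : 0 < 1 - r1 / r2).
  { enough (r1 / r2 < 1) by lra. apply Rlt_div_l; unfold r2 in *; lra. }
  split; [apply Rmult_le_pos; [lra|left; now apply Rinv_0_lt_compat]|].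
  split; [lra|]. intros z Hz.
  assert (Hz1 : Cmod z < r1).
  { replace z with ((z - z0) + z0)%C by ring.
    eapply Rle_lt_trans; [apply Cmod_triangle|]. unfold r1. lra. }
  split; [lra|].
  destruct (is_pseries_geom_bound a r2 M z HM) as [l [Hl Hbd]]; [lra|].
  rewrite (is_pseries_Cunique _ _ _ _ (HF z ltac:(unfold in_disk; lra)) Hl).
  eapply Rle_trans; [exact Hbd|].
  apply Rmult_le_compat_l; [exact HM0|].
  apply Rinv_le_contravar; [exact Hq|].
  enough (Cmod z / r2 <= r1 / r2) by lra.
  apply Rmult_le_compat_r; [|lra]. left; apply Rinv_0_lt_compat. unfold r2; lra.
Qed.

(** * Derivatives of power series *)

Lemma is_derive_of_quadratic_error (F : C -> C) (z0 l : C) (K d : R) :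
  0 <= K -> 0 < d ->
  (forall z, Cmod (z - z0) < d ->
     Cmod (F z - F z0 - (z - z0) * l) <= K * (Cmod (z - z0) * Cmod (z - z0))) ->
  @is_derive C_AbsRing C_NormedModule F z0 l.
Proof.
  intros HK Hd H. split.
  - apply is_linear_scal_l.
  - intros x Hx. apply (@is_filter_lim_locally_unique C_AbsRing (AbsRing_NormedModule C_AbsRing)) in Hx. subst x.
    intros eps.
    (* Within this radius K |z - z0| is at most [eps]; the added 1 covers the case [K = 0]. *)
    assert (Hpos : 0 < Rmin d (eps / (K + 1))).
    { apply Rmin_pos; [exact Hd|]. apply Rdiv_lt_0_compat; [apply cond_pos|lra]. }
    apply (@locally_le_locally_norm C_AbsRing (AbsRing_NormedModule C_AbsRing)).
    exists (mkposreal _ Hpos). intros z Hz.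
    change (Cmod (z - z0) < Rmin d (eps / (K + 1))) in Hz.
    change (Cmod ((F z - F z0) - ((z - z0) * l)) <= eps * Cmod (z - z0)).
    assert (H1 : Cmod (z - z0) < d) by (eapply Rlt_le_trans; [exact Hz|apply Rmin_l]).
    assert (H2 : Cmod (z - z0) < eps / (K + 1)) by (eapply Rlt_le_trans; [exact Hz|apply Rmin_r]).
    apply Rlt_div_r in H2; [|lra].
    eapply Rle_trans; [exact (H z H1)|].
    pose proof (Cmod_ge_0 (z - z0)). rewrite <- Rmult_assoc.
    apply Rmult_le_compat_r; [assumption|]. nra.
Qed.

(** Bernoulli's inequality (1 + x)^n >= 1 + n x with x = 1/s - 1. *)
Lemma INR_pow_bounded (s : R) : 0 < s < 1 -> exists M, forall n, INR n * s ^ n <= M.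
Proof.
  intros Hs. exists (/ (/ s - 1)). intros n.
  assert (Hx : 0 < / s - 1).
  { assert (s * / s = 1) by (field; lra). assert (0 < / s) by (apply Rinv_0_lt_compat; lra). nra. }
  pose proof (poly n (/ s - 1) Hx) as H.
  replace (1 + (/ s - 1)) with (/ s) in H by ring.
  rewrite pow_inv in H.
  assert (Hsn : 0 < s ^ n) by (apply pow_lt; lra).
  apply (Rmult_le_reg_r (/ s - 1)); [exact Hx|].
  rewrite Rinv_l by lra.
  apply (Rmult_le_compat_r (s ^ n)) in H; [|lra].
  rewrite Rinv_l in H by lra. nra.
Qed.

(** With s^2 = (1 + q)/2 one has q <= s^2 < 1: one factor s^n absorbs the linear growth, the other
    tends to 0. *)
Lemma INR_pow_lim (q : R) : 0 <= q < 1 -> is_lim_seq (fun n => INR (S n) * q ^ n) 0.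
Proof.
  intros Hq.
  set (s := sqrt ((1 + q) / 2)).
  assert (Hs2 : s * s = (1 + q) / 2) by (apply sqrt_sqrt; lra).
  assert (Hs0 : 0 < s) by (apply sqrt_lt_R0; lra).
  assert (Hs : s < 1) by nra.
  destruct (INR_pow_bounded s) as [M HM]; [lra|].
  apply (is_lim_seq_le_le (fun _ => 0) _ (fun n => (M + 1) * s ^ n)).
  - intros n. split.
    + apply Rmult_le_pos; [apply pos_INR|apply pow_le; lra].
    + assert (Hp : q ^ n <= s ^ n * s ^ n).
      { rewrite <- Rpow_mult_distr. apply pow_incr. lra. }
      assert (H0 : 0 <= s ^ n) by (apply pow_le; lra).
      assert (H1 : s ^ n <= 1).
      { rewrite <- (pow1 n). apply pow_incr. lra. }
      specialize (HM n). rewrite S_INR. pose proof (pos_INR n).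
      assert (Hm : (INR n + 1) * s ^ n <= M + 1) by lra.
      apply Rle_trans with ((INR n + 1) * (s ^ n * s ^ n)).
      * apply Rmult_le_compat_l; lra.
      * rewrite <- Rmult_assoc. apply Rmult_le_compat_r; lra.
  - apply is_lim_seq_const.
  - replace 0 with ((M + 1) * 0) by ring.
    apply (is_lim_seq_scal_l (fun n => s ^ n) (M + 1) 0).
    apply is_lim_seq_geom. rewrite Rabs_pos_eq; lra.
Qed.

(** Dividing by z - z0 twice gives F = F(z0) + (z - z0) G(z0) + (z - z0)^2 H with [H] locally
    bounded, hence F'(z0) = G(z0) with a quadratic error. The series of z F' then comes from that of
    [G] by partial summation. *)
Lemma expands_is_derive (a : nat -> C) (F : C -> C) (z0 : C) :
  expands a F -> in_disk z0 ->
  @is_derive C_AbsRing C_NormedModule F z0 (C_derive F z0) /\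
  @is_pseries C_AbsRing C_NormedModule (fun n => RtoC (INR n) * a n)%C z0 (z0 * C_derive F z0)%C /\
  exists K d, 0 <= K /\ 0 < d /\ forall z, Cmod (z - z0) < d ->
    Cmod (F z - F z0 - (z - z0) * C_derive F z0) <= K * (Cmod (z - z0) * Cmod (z - z0)).
Proof.
  intros HF Hz0.
  destruct (expands_factor a F z0 HF Hz0) as [b [G [HG [Hb EF]]]].
  destruct (expands_factor b G z0 HG Hz0) as [c [H [HH [_ EG]]]].
  assert (Herr : exists K d, 0 <= K /\ 0 < d /\ forall z, Cmod (z - z0) < d ->
    Cmod (F z - F z0 - (z - z0) * G z0) <= K * (Cmod (z - z0) * Cmod (z - z0))).
  { destruct (expands_locally_bounded c H z0 HH Hz0) as [K [d [HK [Hd Hbd]]]].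
    exists K, d. split; [exact HK|]. split; [exact Hd|].
    intros z Hz. destruct (Hbd z Hz) as [Hz1 Hz2].
    rewrite (EF z Hz1), (EG z Hz1).
    replace (F z0 + (z - z0) * (G z0 + (z - z0) * H z) - F z0 - (z - z0) * G z0)%C
      with (H z * ((z - z0) * (z - z0)))%C by ring.
    rewrite !Cmod_mult. apply Rmult_le_compat_r; [|exact Hz2].
    apply Rmult_le_pos; apply Cmod_ge_0. }
  assert (HD : @is_derive C_AbsRing C_NormedModule F z0 (G z0)).
  { destruct Herr as [K [d [HK [Hd Hz]]]].
    exact (is_derive_of_quadratic_error F z0 (G z0) K d HK Hd Hz). }
  pose proof (is_C_derive_unique F z0 (G z0) HD) as EQ. rewrite EQ.
  split; [exact HD|]. split; [|exact Herr]. clear Herr.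
  set (u := fun k => @scal C_AbsRing C_NormedModule (@pow_n C_Ring z0 k) (RtoC (INR k) * a k)%C).
  set (v := fun k => @scal C_AbsRing C_NormedModule (@pow_n C_Ring z0 k) (b k)).
  set (w := fun k => (- (RtoC (INR (S k)) * z0 ^ S k * b k))%C).
  (* Partial summation based on b_n = a_(n+1) + z0 b_(n+1); [w N] is the boundary term. *)
  assert (E : forall N, plus (scal z0 (sum_n v N)) (w N) = sum_n u N).
  { intros N. induction N as [|N IH].
    - rewrite !sum_O. unfold v, u, w.
      change ((z0 * (1 * b 0%nat) + - (RtoC 1 * (z0 * 1) * b 0%nat) = 1 * (0 * a 0%nat))%C). ring.
    - rewrite !sum_Sn, <- IH.
      change ((z0 * (sum_n v N + v (S N)) + w (S N) = z0 * sum_n v N + w N + u (S N))%C).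
      unfold v at 2, u, w.
      change ((z0 * (sum_n v N + @pow_n C_Ring z0 (S N) * b (S N)) + - (RtoC (INR (S (S N))) * z0 ^ S (S N) * b (S N))
       = z0 * sum_n v N + - (RtoC (INR (S N)) * z0 ^ S N * b N) + @pow_n C_Ring z0 (S N) * (RtoC (INR (S N)) * a (S N)))%C).
      rewrite pow_n_Cpow, (Hb N), (S_INR (S N)), RtoC_plus.
      change (z0 ^ S (S N))%C with (z0 * z0 ^ S N)%C. ring. }
  refine (filterlim_ext _ _ E _).
  replace (z0 * G z0)%C with (plus (scal z0 (G z0)) (@zero C_NormedModule)).
  2:{ change ((z0 * G z0 + 0)%C = (z0 * G z0)%C). ring. }
  refine (filterlim_comp_2 (fun N => scal z0 (sum_n v N)) w (@plus C_NormedModule) _ _ (filterlim_plus _ _)).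
  { refine (filterlim_comp _ _ _ _ _ _ _ _ (HG z0 Hz0) (@filterlim_scal_r C_AbsRing C_NormedModule z0 (G z0))). }
  apply (@filterlim_norm_zero nat C_AbsRing C_NormedModule eventually _).
  unfold in_disk in Hz0. pose proof (Cmod_ge_0 z0) as Hz0'.
  (* As |b_n| r^n is bounded for this r > |z0|, the boundary term is O(n (|z0|/r)^n) and vanishes in
     the limit. *)
  set (r := (1 + Cmod z0) / 2).
  destruct (expands_bounded b G r HG) as [M [HM0 HM]]; [unfold r; lra|].
  assert (Hr : 0 < r) by (unfold r; lra).
  assert (Hq : 0 <= Cmod z0 / r < 1).
  { split; [apply Rdiv_le_0_compat; lra|]. apply Rlt_div_l; unfold r in *; lra. }
  change (is_lim_seq (fun n => Cmod (w n)) 0).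
  apply (is_lim_seq_le_le (fun _ => 0) _ (fun n => M * Cmod z0 * (INR (S n) * (Cmod z0 / r) ^ n))).
  - intros n. change (0 <= Cmod (w n) <= M * Cmod z0 * (INR (S n) * (Cmod z0 / r) ^ n)).
    split; [apply Cmod_ge_0|].
    unfold w. rewrite Cmod_opp, !Cmod_mult, Cmod_R, Cmod_pow.
    rewrite Rabs_pos_eq by apply pos_INR.
    replace (Cmod z0 ^ S n) with (Cmod z0 * (r ^ n * (Cmod z0 / r) ^ n)).
    2:{ rewrite <- Rpow_mult_distr. cbn [pow]. do 2 f_equal. field. lra. }
    specialize (HM n).
    replace (INR (S n) * (Cmod z0 * (r ^ n * (Cmod z0 / r) ^ n)) * Cmod (b n))
      with (Cmod (b n) * r ^ n * (Cmod z0 * (INR (S n) * (Cmod z0 / r) ^ n))) by ring.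
    rewrite (Rmult_assoc M). apply Rmult_le_compat_r; [|exact HM].
    apply Rmult_le_pos; [exact Hz0'|]. apply Rmult_le_pos; [apply pos_INR|apply pow_le; lra].
  - apply is_lim_seq_const.
  - replace 0 with (M * Cmod z0 * 0) by ring.
    refine (is_lim_seq_scal_l _ (M * Cmod z0) 0 _). apply INR_pow_lim. exact Hq.
Qed.

Lemma expands_z_derive (a : nat -> C) (F : C -> C) :
  expands a F -> expands (fun n => RtoC (INR n) * a n)%C (fun z => z * C_derive F z)%C.
Proof. intros HF z Hz. now apply (expands_is_derive a F z). Qed.

(** * Maxima of continuous functions on a closed disk *)

Definition continuous_at (u : C -> R) (z : C) : Prop :=
  forall eps, 0 < eps -> exists d, 0 < d /\
    forall w, Cmod (w - z) < d -> Rabs (u w - u z) < eps.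

Lemma closed_disk_max (u : C -> R) (r : R) :
  0 <= r -> (forall z, Cmod z <= r -> continuous_at u z) ->
  exists z0, Cmod z0 <= r /\ forall z, Cmod z <= r -> u z <= u z0.
Proof.
  intros Hr Hu.
  (* Compactness in the form used twice below: a property of points and scales that is inherited by
     smaller scales and holds locally at some scale holds on the whole disk at one scale. *)
  assert (cover : forall P : C -> R -> Prop,
    (forall p, Cmod p <= r -> exists d, 0 < d /\ forall z, Cmod z <= r -> Cmod (z - p) < d -> P z d) ->
    (forall z d d', 0 < d' <= d -> P z d -> P z d') ->
    exists d, 0 < d /\ forall z, Cmod z <= r -> P z d).
  { intros P HP Hmono.
    assert (HP' : forall p : C, exists d : posreal, forall z, Cmod z <= r ->
       Cmod (z - p) < 2 * d -> P z d).
    { intros p. destruct (Rle_dec (Cmod p) r) as [Hp|Hp].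
      - destruct (HP p Hp) as [d [Hd H]].
        assert (Hd2 : 0 < d / 2) by lra. exists (mkposreal _ Hd2). cbn. intros z Hz Hzp.
        apply (Hmono z d); [lra|]. apply H; lra.
      (* The compactness theorem covers the square around the disk; a centre outside the disk gets a
         radius too small to reach it. *)
      - assert (Hd2 : 0 < (Cmod p - r) / 2) by lra. exists (mkposreal _ Hd2). cbn.
        intros z Hz Hzp. exfalso.
        assert (Cmod p <= Cmod z + Cmod (z - p)); [|lra].
        replace p with (z + - (z - p))%C at 1 by ring.
        eapply Rle_trans; [apply Cmod_triangle|]. rewrite Cmod_opp. lra. }
    set (delta := fun x y => proj1_sig (constructive_indefinite_description _ (HP' (x, y)))).
    destruct (compactness_value_2d (- r) r (- r) r delta) as [d Hd].
    exists d. split; [apply cond_pos|]. intros z Hz.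
    destruct (Classical_Prop.classic (P z d)) as [|Hn]; [assumption|exfalso].
    pose proof (Rmax_Cmod z) as Hm.
    pose proof (Rmax_l (Rabs (fst z)) (Rabs (snd z))).
    pose proof (Rmax_r (Rabs (fst z)) (Rabs (snd z))).
    apply (Hd (fst z) (snd z)).
    - apply Rabs_le_between. lra.
    - apply Rabs_le_between. lra.
    - intros [x [y [_ [_ [H1 [H2 H3]]]]]]. apply Hn.
      unfold delta in *.
      destruct (constructive_indefinite_description _ (HP' (x, y))) as [e He]. cbn in *.
      apply (Hmono z e); [split; [apply cond_pos|exact H3]|].
      apply He; [exact Hz|].
      (* The covering is by squares; since sqrt 2 <= 2, a square of half-side [e] lies in the disk
         of radius 2 e, whence the factor 2 in [HP']. *)
      eapply Rle_lt_trans; [apply Cmod_2Rmax|].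
      assert (Hs : sqrt 2 <= 2).
      { rewrite <- (sqrt_Rsqr 2) at 2 by lra. apply sqrt_le_1_alt. unfold Rsqr. lra. }
      assert (Hmx : Rmax (Rabs (fst (z - (x, y))%C)) (Rabs (snd (z - (x, y))%C)) < e).
      { apply Rmax_lub_lt; [exact H1|exact H2]. }
      pose proof (Rabs_pos (fst (z - (x, y))%C)).
      pose proof (Rmax_l (Rabs (fst (z - (x, y))%C)) (Rabs (snd (z - (x, y))%C))).
      pose proof (sqrt_pos 2). pose proof (cond_pos e). nra. }
  (* First use: local bounds on [u], with the bound encoded as the inverse of a scale, become a
     global one. *)
  assert (Hbd : exists d, 0 < d /\ forall z, Cmod z <= r -> u z <= / d).
  { apply (cover (fun z d => u z <= / d)).
    - intros p Hp. destruct (Hu p Hp 1 Rlt_0_1) as [d [Hd H]].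
      set (m := Rabs (u p) + 1). assert (Hm : 0 < m) by (unfold m; pose proof (Rabs_pos (u p)); lra).
      exists (Rmin d (/ m)). assert (Hmin : 0 < Rmin d (/ m)).
      { apply Rmin_pos; [exact Hd|now apply Rinv_0_lt_compat]. }
      split; [exact Hmin|]. intros z _ Hz.
      apply Rle_trans with m.
      + assert (H1 : Cmod (z - p) < d) by (eapply Rlt_le_trans; [exact Hz|apply Rmin_l]).
        specialize (H z H1). apply Rabs_def2 in H. unfold m.
        pose proof (Rle_abs (u p)). lra.
      + rewrite <- (Rinv_inv m) at 1. apply Rinv_le_contravar; [exact Hmin|apply Rmin_r].
    - intros z d d' [H1 H2] H. eapply Rle_trans; [exact H|]. now apply Rinv_le_contravar. }
  destruct Hbd as [d0 [Hd0 Hbd]].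
  destruct (completeness (fun y => exists z, Cmod z <= r /\ y = u z)) as [M [HM1 HM2]].
  { exists (/ d0). intros y [z [Hz ->]]. now apply Hbd. }
  { exists (u (RtoC 0)), (RtoC 0). split; [rewrite Cmod_0; exact Hr|reflexivity]. }
  assert (HM : forall z, Cmod z <= r -> u z <= M).
  { intros z Hz. apply HM1. now exists z. }
  destruct (Classical_Prop.classic (exists z0, Cmod z0 <= r /\ M <= u z0)) as [[z0 [Hz0 H0]]|Hno].
  { exists z0. split; [exact Hz0|]. intros z Hz. specialize (HM z Hz). lra. }
  exfalso.
  (* Second use: were the supremum [M] not attained, [u] would stay below [M] by a uniform gap,
     against its minimality. *)
  destruct (cover (fun z d => u z <= M - d)) as [d [Hd H]].
  - intros p Hp.
    assert (Hup : u p < M).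
    { apply Rnot_le_lt. intros Hc. apply Hno. now exists p. }
    destruct (Hu p Hp ((M - u p) / 2)) as [d [Hd H]]; [lra|].
    exists (Rmin d ((M - u p) / 2)). split; [apply Rmin_pos; lra|].
    intros z _ Hz.
    assert (H1 : Cmod (z - p) < d) by (eapply Rlt_le_trans; [exact Hz|apply Rmin_l]).
    specialize (H z H1). apply Rabs_def2 in H.
    pose proof (Rmin_r d ((M - u p) / 2)). lra.
  - intros z d d' Hd H. lra.
  - enough (M <= M - d) by lra. apply HM2. intros y [z [Hz ->]]. now apply H.
Qed.

(** * The maximum principle and Schwarz's lemma *)

(** A - (A(z0)/B(z0)) B vanishes at [z0] and is divisible by z - z0. The denominator [B] is
    unchanged, so the step can be iterated to give Taylor expansions of A/B without dividing power
    series. *)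
Lemma quotient_factor (a b : nat -> C) (A B : C -> C) (z0 : C) :
  expands a A -> expands b B -> (forall z, in_disk z -> B z <> RtoC 0) -> in_disk z0 ->
  exists a' A', expands a' A' /\
    forall z, in_disk z -> (A z / B z = A z0 / B z0 + (z - z0) * (A' z / B z))%C.
Proof.
  intros HA HB HB0 Hz0.
  destruct (expands_factor _ _ z0
    (expands_plus _ _ _ _ HA (expands_scal (- (A z0 / B z0))%C _ _ HB)) Hz0)
    as [a' [A' [HA' [_ E]]]].
  exists a', A'. split; [exact HA'|]. intros z Hz.
  pose proof (HB0 z Hz). pose proof (HB0 z0 Hz0).
  specialize (E z Hz). cbv beta in E.
  replace (A z0 + - (A z0 / B z0) * B z0)%C with (RtoC 0) in E by (field; assumption).
  replace (A z) with ((A z0 / B z0) * B z + (z - z0) * A' z)%C.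
  - field; split; assumption.
  - rewrite Cplus_0_l in E. rewrite <- E. ring.
Qed.

Lemma quotient_locally_bounded (a b : nat -> C) (A B : C -> C) (z0 : C) :
  expands a A -> expands b B -> (forall z, in_disk z -> B z <> RtoC 0) -> in_disk z0 ->
  exists K d, 0 <= K /\ 0 < d /\
    forall z, Cmod (z - z0) < d -> in_disk z /\ Cmod (A z / B z) <= K.
Proof.
  intros HA HB HB0 Hz0.
  destruct (expands_locally_bounded a A z0 HA Hz0) as [KA [dA [HKA [HdA HbA]]]].
  destruct (expands_factor b B z0 HB Hz0) as [c [G [HG [_ EB]]]].
  destruct (expands_locally_bounded c G z0 HG Hz0) as [KG [dG [HKG [HdG HbG]]]].
  set (m := Cmod (B z0)).
  assert (Hm : 0 < m) by (apply Cmod_gt_0, HB0, Hz0).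
  (* Within this distance [B] moves by at most m/2 from its value at [z0], so |B| >= m/2. *)
  set (d1 := m / 2 / (KG + 1)).
  assert (Hd1 : 0 < d1) by (unfold d1; apply Rdiv_lt_0_compat; lra).
  exists (KA / (m / 2)), (Rmin d1 (Rmin dA dG)).
  split; [apply Rdiv_le_0_compat; lra|].
  split; [repeat apply Rmin_pos; assumption|].
  intros z Hz.
  pose proof (Rmin_l d1 (Rmin dA dG)). pose proof (Rmin_r d1 (Rmin dA dG)).
  pose proof (Rmin_l dA dG). pose proof (Rmin_r dA dG).
  destruct (HbA z) as [Hzd HAz]; [lra|]. destruct (HbG z) as [_ HGz]; [lra|].
  split; [exact Hzd|].
  assert (HBz : m / 2 <= Cmod (B z)).
  { assert (Hs : Cmod ((z - z0) * G z) <= m / 2).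
    { rewrite Cmod_mult. pose proof (Cmod_ge_0 (z - z0)). pose proof (Cmod_ge_0 (G z)).
      apply Rle_trans with (d1 * (KG + 1)).
      - apply Rmult_le_compat; lra.
      - unfold d1. right. field. lra. }
    assert (m <= Cmod (B z) + Cmod ((z - z0) * G z)); [|lra].
    unfold m. replace (B z0) with (B z + - ((z - z0) * G z))%C.
    - eapply Rle_trans; [apply Cmod_triangle|]. rewrite Cmod_opp. lra.
    - rewrite (EB z Hzd) at 1. ring. }
  rewrite Cmod_div by (now apply HB0).
  apply Rmult_le_compat; [apply Cmod_ge_0| |exact HAz|].
  - left. apply Rinv_0_lt_compat. lra.
  - apply Rinv_le_contravar; lra.
Qed.

Lemma quotient_lipschitz_at (a b : nat -> C) (A B : C -> C) (z0 : C) :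
  expands a A -> expands b B -> (forall z, in_disk z -> B z <> RtoC 0) -> in_disk z0 ->
  exists K d, 0 <= K /\ 0 < d /\
    forall z, Cmod (z - z0) < d -> Cmod (A z / B z - A z0 / B z0) <= K * Cmod (z - z0).
Proof.
  intros HA HB HB0 Hz0.
  destruct (quotient_factor a b A B z0 HA HB HB0 Hz0) as [a1 [A1 [HA1 E1]]].
  destruct (quotient_locally_bounded a1 b A1 B z0 HA1 HB HB0 Hz0) as [K [d [HK [Hd Hbd]]]].
  exists K, d. split; [exact HK|]. split; [exact Hd|]. intros z Hz.
  destruct (Hbd z Hz) as [Hzd HKz]. rewrite (E1 z Hzd).
  replace (A z0 / B z0 + (z - z0) * (A1 z / B z) - A z0 / B z0)%C
    with ((A1 z / B z) * (z - z0))%C by ring.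
  rewrite Cmod_mult. apply Rmult_le_compat_r; [apply Cmod_ge_0|exact HKz].
Qed.

Lemma quotient_second_order (a b : nat -> C) (A B : C -> C) (z0 : C) :
  expands a A -> expands b B -> (forall z, in_disk z -> B z <> RtoC 0) -> in_disk z0 ->
  exists q1 q2 K d, 0 <= K /\ 0 < d /\
    forall h, Cmod h < d ->
      Cmod (A (z0 + h)%C / B (z0 + h)%C - (A z0 / B z0 + h * q1 + h * h * q2)) <= K * Cmod h ^ 3.
Proof.
  intros HA HB HB0 Hz0.
  destruct (quotient_factor a b A B z0 HA HB HB0 Hz0) as [a1 [A1 [HA1 E1]]].
  destruct (quotient_factor a1 b A1 B z0 HA1 HB HB0 Hz0) as [a2 [A2 [HA2 E2]]].
  destruct (quotient_factor a2 b A2 B z0 HA2 HB HB0 Hz0) as [a3 [A3 [HA3 E3]]].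
  destruct (quotient_locally_bounded a3 b A3 B z0 HA3 HB HB0 Hz0) as [K [d [HK [Hd Hbd]]]].
  exists (A1 z0 / B z0)%C, (A2 z0 / B z0)%C, K, d.
  split; [exact HK|]. split; [exact Hd|]. intros h Hh.
  assert (Eh : (z0 + h - z0 = h)%C) by ring.
  destruct (Hbd (z0 + h)%C) as [Hzd HKz]; [now rewrite Eh|].
  rewrite (E1 _ Hzd), (E2 _ Hzd), (E3 _ Hzd), Eh.
  set (X := (A3 (z0 + h) / B (z0 + h))%C) in *.
  match goal with |- Cmod ?t <= _ => replace t with (X * (h * (h * h)))%C by ring end.
  rewrite !Cmod_mult.
  replace (Cmod h * (Cmod h * Cmod h)) with (Cmod h ^ 3) by ring.
  apply Rmult_le_compat_r; [apply pow_le, Cmod_ge_0|exact HKz].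
Qed.

Lemma Cmod_sqr (z : C) : Cmod z ^ 2 = Re z * Re z + Im z * Im z.
Proof. rewrite Cmod2_alt. ring. Qed.

Lemma Re_ge_of_close (x y : C) (e : R) : Cmod (x - y) <= e -> Re y - e <= Re x.
Proof.
  intros H. pose proof (re_le_Cmod (x - y)) as H1.
  change (Re (x - y)) with (Re x - Re y) in H1.
  assert (H2 : Rabs (Re x - Re y) <= e) by lra.
  apply Rabs_le_between in H2. lra.
Qed.

(* Averaging over h, ih, -h, -ih kills the terms of order 1 and 2 of A/B, whereas
   eps |z|^2 gains eps |h|^2; so Re (A/B) + eps |z|^2 has no interior maximum. *)
Lemma quotient_no_interior_max (a b : nat -> C) (A B : C -> C) (z0 : C) (eps rad : R) :
  expands a A -> expands b B -> (forall z, in_disk z -> B z <> RtoC 0) -> in_disk z0 ->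
  0 < eps -> 0 < rad ->
  ~ (forall h, Cmod h < rad ->
      Re (A (z0 + h)%C / B (z0 + h)%C) + eps * Cmod (z0 + h) ^ 2
      <= Re (A z0 / B z0) + eps * Cmod z0 ^ 2).
Proof.
  intros HA HB HB0 Hz0 Heps Hrad Hmax.
  destruct (quotient_second_order a b A B z0 HA HB HB0 Hz0)
    as [q1 [q2 [K [d [HK [Hd Hq]]]]]].
  set (e1 := eps / (K + 1)). assert (He1 : 0 < e1) by (unfold e1; apply Rdiv_lt_0_compat; lra).
  (* Besides keeping the four points in range, [t] satisfies K t < eps, so the cubic error loses to
     the gain eps t^2. *)
  set (t := Rmin e1 (Rmin rad d) / 2).
  assert (Hmin : 0 < Rmin e1 (Rmin rad d)) by (repeat apply Rmin_pos; assumption).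
  pose proof (Rmin_l e1 (Rmin rad d)). pose proof (Rmin_r e1 (Rmin rad d)).
  pose proof (Rmin_l rad d). pose proof (Rmin_r rad d).
  assert (Ht : 0 < t) by (unfold t; lra).
  assert (Htr : t < rad) by (unfold t; lra).
  assert (Htd : t < d) by (unfold t; lra).
  assert (HKt : K * t < eps).
  { assert (Hte : t < e1) by (unfold t; lra).
    assert (e1 * (K + 1) = eps) by (unfold e1; field; lra). nra. }
  assert (step : forall h, Cmod h = t ->
     Re (h * q1 + h * h * q2) - K * t ^ 3 + eps * (Cmod (z0 + h) ^ 2 - Cmod z0 ^ 2) <= 0).
  { intros h Hh. specialize (Hmax h ltac:(lra)). specialize (Hq h ltac:(lra)).
    rewrite Hh in Hq. apply Re_ge_of_close in Hq.
    change (Re (A z0 / B z0 + h * q1 + h * h * q2))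
      with (Re (A z0 / B z0) + Re (h * q1) + Re (h * h * q2)) in Hq.
    change (Re (h * q1 + h * h * q2)) with (Re (h * q1) + Re (h * h * q2)). lra. }
  assert (M1 : Cmod (RtoC t) = t) by (rewrite Cmod_R; apply Rabs_pos_eq; lra).
  assert (M2 : Cmod (Ci * t) = t) by (rewrite Cmod_mult, Cmod_Ci, M1; ring).
  pose proof (step (RtoC t) M1) as S1.
  pose proof (step (- RtoC t)%C ltac:(now rewrite Cmod_opp)) as S2.
  pose proof (step (Ci * t)%C M2) as S3.
  pose proof (step (- (Ci * t))%C ltac:(now rewrite Cmod_opp)) as S4.
  rewrite !Cmod_sqr in S1, S2, S3, S4.
  destruct q1 as [p s], q2 as [m n], z0 as [x y]. cbn in S1, S2, S3, S4.
  assert (4 * eps * (t * t) - 4 * K * t ^ 3 <= 0) by nra.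
  assert (eps * (t * t) - K * t * (t * t) > 0); [|nra].
  assert (0 < t * t) by nra. nra.
Qed.

(** The function Re (A/B) + eps |z|^2 attains its maximum on the closed disk, necessarily on the
    bounding circle; the perturbation costs at most [eps], which is arbitrary. *)
Lemma quotient_max_principle (a b : nat -> C) (A B : C -> C) (r M : R) :
  expands a A -> expands b B -> (forall z, in_disk z -> B z <> RtoC 0) -> 0 <= r < 1 ->
  (forall z, Cmod z = r -> Re (A z / B z) <= M) ->
  forall z, Cmod z <= r -> Re (A z / B z) <= M.
Proof.
  intros HA HB HB0 Hr Hbd z Hz.
  apply le_epsilon. intros eps Heps.
  set (u := fun z => Re (A z / B z) + eps * Cmod z ^ 2).
  destruct (closed_disk_max u r) as [z0 [Hz0 Hmax]]; [lra| |].
  - intros w Hw e He.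
    assert (Hwd : in_disk w) by (unfold in_disk; lra).
    destruct (quotient_lipschitz_at a b A B w HA HB HB0 Hwd) as [K [d [HK [Hd HL]]]].
    (* [K] is a local Lipschitz constant of A/B, and 3 bounds |w'| + |w| when |w| < 1 and |w' - w| <
       1. *)
    set (L := K + eps * 3). assert (HLp : 0 < L) by (unfold L; lra).
    exists (Rmin (e / L) (Rmin d 1)).
    assert (0 < e / L) by now apply Rdiv_lt_0_compat.
    split; [repeat apply Rmin_pos; lra|]. intros w' Hw'.
    pose proof (Rmin_l (e / L) (Rmin d 1)). pose proof (Rmin_r (e / L) (Rmin d 1)).
    pose proof (Rmin_l d 1). pose proof (Rmin_r d 1).
    specialize (HL w' ltac:(lra)).
    set (dl := Cmod (w' - w)) in *. assert (Hdl : 0 <= dl) by apply Cmod_ge_0.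
    assert (Hdle : L * dl < e).
    { assert (Hlt : dl < e / L) by lra. apply Rlt_div_r in Hlt; [|exact HLp]. lra. }
    assert (T1 : Cmod w' <= Cmod w + dl).
    { replace w' with (w + (w' - w))%C at 1 by ring. apply Cmod_triangle. }
    assert (T2 : Cmod w <= Cmod w' + dl).
    { replace w with (w' + - (w' - w))%C at 1 by ring.
      eapply Rle_trans; [apply Cmod_triangle|]. rewrite Cmod_opp. unfold dl. lra. }
    pose proof (Cmod_ge_0 w). pose proof (Cmod_ge_0 w').
    assert (Sq : Rabs (Cmod w' ^ 2 - Cmod w ^ 2) <= 3 * dl).
    { apply Rabs_le_between. split; nra. }
    pose proof (re_le_Cmod (A w' / B w' - A w / B w)) as HR.
    change (Re (A w' / B w' - A w / B w)) with (Re (A w' / B w') - Re (A w / B w)) in HR.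
    assert (HR' : Rabs (Re (A w' / B w') - Re (A w / B w)) <= K * dl) by lra.
    apply Rabs_le_between in HR'. apply Rabs_le_between in Sq.
    apply Rabs_lt_between. unfold u, L in *. split; nra.
  - pose proof (Hmax z Hz) as Hmaxz. unfold u in Hmaxz.
    pose proof (Cmod_ge_0 z0) as Hz0p. pose proof (pow2_ge_0 (Cmod z)).
    destruct (Rle_lt_or_eq_dec _ _ Hz0) as [Hlt|Heq].
    + exfalso.
      apply (quotient_no_interior_max a b A B z0 eps (r - Cmod z0) HA HB HB0);
        [unfold in_disk; lra|exact Heps|lra|].
      intros h Hh. apply Hmax. pose proof (Cmod_triangle z0 h). lra.
    + specialize (Hbd z0 Heq). rewrite Heq in Hmaxz.
      assert (r ^ 2 <= 1) by nra.
      assert (0 <= eps * Cmod z ^ 2) by (apply Rmult_le_pos; lra).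
      assert (eps * r ^ 2 <= eps * 1) by (apply Rmult_le_compat_l; lra). lra.
Qed.

(** Schwarz's lemma for A/B: on the circle |z| = r the hypothesis reads |A/B| <= 1/r, the maximum
    principle carries this inside, and r can be taken close to 1. *)
Lemma schwarz_quotient (a b : nat -> C) (A B : C -> C) :
  expands a A -> expands b B -> (forall z, in_disk z -> B z <> RtoC 0) ->
  (forall z, in_disk z -> Cmod (z * A z) <= Cmod (B z)) ->
  forall z, in_disk z -> Cmod (A z) <= Cmod (B z).
Proof.
  intros HA HB HB0 Hle z1 Hz1.
  pose proof (HB0 z1 Hz1) as HBz1. apply Cmod_gt_0 in HBz1.
  set (Q := Cmod (A z1 / B z1)).
  enough (HQ : Q <= 1).
  { unfold Q in HQ. rewrite Cmod_div in HQ by now apply HB0.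
    apply -> Rle_div_l in HQ; lra. }
  apply Rnot_lt_le. intros HQ.
  unfold in_disk in Hz1. pose proof (Cmod_ge_0 z1).
  (* The circle must enclose [z1] and have radius above 1/Q, so that the resulting Q <= 1/r
     contradicts Q > 1. *)
  set (r := Rmax ((1 + Cmod z1) / 2) ((1 + / Q) / 2)).
  assert (HQi : 0 < / Q < 1).
  { split; [apply Rinv_0_lt_compat; lra|]. rewrite <- Rinv_1. apply Rinv_lt_contravar; lra. }
  assert (Hr1 : (1 + Cmod z1) / 2 <= r) by apply Rmax_l.
  assert (Hr2 : (1 + / Q) / 2 <= r) by apply Rmax_r.
  assert (Hr3 : r < 1) by (unfold r; apply Rmax_lub_lt; lra).
  (* This factor makes the value at [z1] equal to Q^2, so a bound on real parts yields one on the
     modulus. *)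
  set (l := Cconj (A z1 / B z1)).
  assert (Hmain : Re (l * A z1 / B z1) <= Q * / r).
  { apply (quotient_max_principle _ b (fun z => l * A z)%C B r (Q * / r)
             (expands_scal l a A HA) HB HB0); [unfold r in *; lra| |lra].
    intros z Hz.
    assert (Hzd : in_disk z) by (unfold in_disk; lra).
    eapply Rle_trans; [apply Rle_abs|]. eapply Rle_trans; [apply re_le_Cmod|].
    replace (l * A z / B z)%C with (l * (A z / B z))%C by (unfold Cdiv; ring).
    rewrite Cmod_mult. unfold l. rewrite Cmod_conj. fold Q.
    apply Rmult_le_compat_l; [lra|].
    pose proof (HB0 z Hzd) as HBz. rewrite Cmod_div by exact HBz.
    specialize (Hle z Hzd). rewrite Cmod_mult, Hz in Hle.
    apply Cmod_gt_0 in HBz. apply <- Rle_div_l; [|lra].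
    apply (Rmult_le_reg_l r); [lra|]. rewrite <- Rmult_assoc, Rinv_r by lra. lra. }
  replace (l * A z1 / B z1)%C with (A z1 / B z1 * Cconj (A z1 / B z1))%C in Hmain
    by (unfold l, Cdiv; ring).
  rewrite <- Cmod2_conj, re_RtoC in Hmain. fold Q in Hmain.
  assert (Hr0 : 0 < r) by lra.
  assert (Q * r <= 1).
  { apply (Rmult_le_compat_r r) in Hmain; [|lra].
    rewrite Rmult_assoc, Rinv_l in Hmain by lra. nra. }
  assert (Q * / Q = 1) by (field; lra). nra.
Qed.

(** * Schur's algorithm *)

(** For phi = A/B this is the Schur transform (phi - phi(0)) / (z (1 - conj(phi(0)) phi)) with
    denominators cleared, up to the unimodular factor b_0 / conj(b_0). The strict bound [s < 1]
    keeps the new denominator free of zeros. *)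
Lemma schur_step (a b : nat -> C) (A B : C -> C) (s : R) :
  expands a A -> expands b B -> (forall z, in_disk z -> B z <> RtoC 0) -> 0 <= s < 1 ->
  (forall z, in_disk z -> Cmod (A z) <= s * Cmod (B z)) ->
  exists A1 B1,
    expands (fun n => b O * a (S n) - a O * b (S n))%C A1 /\
    expands (fun n => Cconj (b O) * b n - Cconj (a O) * a n)%C B1 /\
    (forall z, in_disk z -> B1 z <> RtoC 0) /\
    (forall z, in_disk z -> Cmod (A1 z) <= Cmod (B1 z)).
Proof.
  intros HA HB HB0 Hs Hle.
  assert (D0 : in_disk (RtoC 0)) by (unfold in_disk; rewrite Cmod_0; lra).
  assert (Hab : Cmod (a O) <= s * Cmod (b O)).
  { rewrite <- (expands_at_0 _ _ HA), <- (expands_at_0 _ _ HB). now apply Hle. }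
  assert (Hb0 : 0 < Cmod (b O)).
  { apply Cmod_gt_0. rewrite <- (expands_at_0 _ _ HB). now apply HB0. }
  pose proof (expands_plus _ _ _ _ (expands_scal (b O) _ _ HA) (expands_scal (- a O)%C _ _ HB)) as HH.
  destruct (expands_decr _ _ HH) as [A1 [HA1 EH]].
  set (B1 := fun z => (Cconj (b O) * B z + - Cconj (a O) * A z)%C).
  assert (HB1 : expands (fun n => Cconj (b O) * b n - Cconj (a O) * a n)%C B1).
  { refine (expands_ext _ _ _ _ _ (fun z _ => eq_refl)
      (expands_plus _ _ _ _ (expands_scal (Cconj (b O)) _ _ HB) (expands_scal (- Cconj (a O))%C _ _ HA))).
    intros n; cbv beta; ring. }
  assert (HA1' : expands (fun n => b O * a (S n) - a O * b (S n))%C A1).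
  { refine (expands_ext _ _ _ _ _ (fun z _ => eq_refl) HA1). intros n; cbv beta; ring. }
  assert (Hnz : forall z, in_disk z -> B1 z <> RtoC 0).
  { intros z Hz. pose proof (HB0 z Hz) as HBz. apply Cmod_gt_0 in HBz.
    specialize (Hle z Hz). intros E.
    assert (E' : (Cconj (b O) * B z = Cconj (a O) * A z)%C).
    { replace (Cconj (b O) * B z)%C with (B1 z + Cconj (a O) * A z)%C by (unfold B1; ring).
      rewrite E. ring. }
    apply (f_equal Cmod) in E'. rewrite !Cmod_mult, !Cmod_conj in E'.
    pose proof (Cmod_ge_0 (a O)). pose proof (Cmod_ge_0 (A z)).
    assert (P : 0 < Cmod (b O) * Cmod (B z)) by now apply Rmult_lt_0_compat.
    assert (Cmod (a O) * Cmod (A z) <= (s * Cmod (b O)) * (s * Cmod (B z)))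
      by now apply Rmult_le_compat.
    assert (s * s < 1) by nra. nra. }
  exists A1, B1. split; [exact HA1'|]. split; [exact HB1|]. split; [exact Hnz|].
  apply (schwarz_quotient _ _ A1 B1 HA1' HB1 Hnz).
  intros z Hz.
  replace (z * A1 z)%C with (b O * A z + - a O * B z)%C.
  2:{ specialize (EH z Hz). cbv beta in EH. rewrite EH. ring. }
  specialize (Hle z Hz).
  (* The identity behind the disk automorphisms: both factors on the right are nonnegative, so |z
     A1| <= |B1|, and Schwarz's lemma removes the z. *)
  assert (I : Cmod (B1 z) ^ 2 - Cmod (b O * A z + - a O * B z)%C ^ 2
     = (Cmod (b O) ^ 2 - Cmod (a O) ^ 2) * (Cmod (B z) ^ 2 - Cmod (A z) ^ 2)).
  { unfold B1. rewrite !Cmod_sqr.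
    destruct (a O), (b O), (A z), (B z). cbn. ring. }
  pose proof (Cmod_ge_0 (a O)). pose proof (Cmod_ge_0 (A z)).
  pose proof (Cmod_ge_0 (b O)). pose proof (Cmod_ge_0 (B z)).
  assert (Cmod (a O) <= Cmod (b O)) by nra.
  assert (Cmod (A z) <= Cmod (B z)) by nra.
  assert (0 <= Cmod (b O) ^ 2 - Cmod (a O) ^ 2) by nra.
  assert (0 <= Cmod (B z) ^ 2 - Cmod (A z) ^ 2) by nra.
  assert (0 <= (Cmod (b O) ^ 2 - Cmod (a O) ^ 2) * (Cmod (B z) ^ 2 - Cmod (A z) ^ 2))
    by now apply Rmult_le_pos.
  pose proof (Cmod_ge_0 (B1 z)).
  apply Rnot_lt_le. intros Hc.
  pose proof (Cmod_ge_0 (b O * A z + - a O * B z)%C). nra.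
Qed.

(** The Schur step needs a strict contraction, so it is applied to t A with t < 1; this lemma passes
    to t = 1. *)
Lemma continuity_le_at_1 (f : R -> R) :
  continuity_pt f 1 -> (forall t, 0 < t < 1 -> f t <= 0) -> f 1 <= 0.
Proof.
  intros Hc H. apply Rnot_lt_le. intros Hf.
  destruct (Hc (f 1) Hf) as [d [Hd Hd']].
  set (m := Rmin d 1 / 2).
  pose proof (Rmin_l d 1). pose proof (Rmin_r d 1).
  assert (Hm : 0 < m) by (unfold m; assert (0 < Rmin d 1) by (apply Rmin_pos; lra); lra).
  assert (Hm' : m < d) by (unfold m; lra).
  assert (Hm1 : m < 1) by (unfold m; lra).
  specialize (H (1 - m) ltac:(lra)).
  assert (Hlt : Rabs (f (1 - m) - f 1) < f 1).
  { apply Hd'. split.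
    - split; [exact I|]. lra.
    - cbn. unfold Rdist. replace (1 - m - 1) with (- m) by ring.
      rewrite Rabs_Ropp, Rabs_pos_eq; lra. }
  apply Rabs_def2 in Hlt. lra.
Qed.

Lemma scaled_bound (A B : C -> C) (t : R) :
  0 < t < 1 ->
  (forall z, in_disk z -> Cmod (A z) <= Cmod (B z)) ->
  forall z, in_disk z -> Cmod (RtoC t * A z) <= t * Cmod (B z).
Proof.
  intros Ht Hle z Hz. rewrite Cmod_mult, Cmod_R, Rabs_pos_eq by lra.
  apply Rmult_le_compat_l; [lra|now apply Hle].
Qed.

(** The bound |phi'(0)| <= 1 - |phi(0)|^2 for phi = A/B, multiplied by |b_0|^2. It is the Schur
    transform's bound at the origin. *)
Lemma schwarz_pick_quotient (a b : nat -> C) (A B : C -> C) :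
  expands a A -> expands b B -> (forall z, in_disk z -> B z <> RtoC 0) ->
  (forall z, in_disk z -> Cmod (A z) <= Cmod (B z)) ->
  Cmod (b 0%nat * a 1%nat - a 0%nat * b 1%nat) <= Cmod (b 0%nat) ^ 2 - Cmod (a 0%nat) ^ 2.
Proof.
  intros HA HB HB0 Hle.
  set (X := Cmod (b 0%nat * a 1%nat - a 0%nat * b 1%nat)).
  set (p := Cmod (b 0%nat)). set (q := Cmod (a 0%nat)).
  (* The factors 1 display the goal as the value at t = 1 of the function in the next line. *)
  enough (K : 1 * X - (p ^ 2 - 1 * 1 * q ^ 2) <= 0) by lra.
  apply (continuity_le_at_1 (fun t => t * X - (p ^ 2 - t * t * q ^ 2))).
  { reg. }
  intros t Ht.
  destruct (schur_step _ b (fun z => RtoC t * A z)%C B t (expands_scal t a A HA) HB HB0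
     ltac:(lra) (scaled_bound A B t Ht Hle)) as [A1 [B1 [HA1 [HB1 [_ Hle1]]]]].
  specialize (Hle1 (RtoC 0) ltac:(unfold in_disk; rewrite Cmod_0; lra)).
  rewrite (expands_at_0 _ _ HA1), (expands_at_0 _ _ HB1) in Hle1. cbv beta in Hle1.
  replace (b 0%nat * (RtoC t * a 1%nat) - RtoC t * a 0%nat * b 1%nat)%C
    with (RtoC t * (b 0%nat * a 1%nat - a 0%nat * b 1%nat))%C in Hle1 by ring.
  rewrite Cmod_mult, Cmod_R, (Rabs_pos_eq t) in Hle1 by lra. fold X in Hle1.
  replace (Cconj (b 0%nat) * b 0%nat - Cconj (RtoC t * a 0%nat) * (RtoC t * a 0%nat))%C
    with (RtoC (p ^ 2 - t * t * q ^ 2)) in Hle1.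
  2:{ unfold p, q. rewrite !Cmod_sqr. destruct (a 0%nat), (b 0%nat).
      apply injective_projections; cbn; ring. }
  rewrite Cmod_R in Hle1.
  assert (Hqp : q <= p).
  { unfold p, q. rewrite <- (expands_at_0 _ _ HA), <- (expands_at_0 _ _ HB).
    apply Hle. unfold in_disk. rewrite Cmod_0. lra. }
  assert (0 <= q) by apply Cmod_ge_0.
  rewrite Rabs_pos_eq in Hle1; [lra|].
  assert (t * t <= 1) by nra. assert (0 <= q ^ 2) by nra. nra.
Qed.

(** The equations say that w1 + w2 z + w3 z^2 begins the Taylor series of A/B. The three bounds come
    from A/B at 0, from Schwarz-Pick for A/B, and from Schwarz-Pick for the Schur transform of t A/B
    as t tends to 1. *)
Lemma schwarz_coefficients (a b : nat -> C) (A B : C -> C) (w1 w2 w3 : C) :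
  expands a A -> expands b B -> (forall z, in_disk z -> B z <> RtoC 0) ->
  (forall z, in_disk z -> Cmod (A z) <= Cmod (B z)) ->
  a 0%nat = (w1 * b 0%nat)%C ->
  a 1%nat = (w1 * b 1%nat + w2 * b 0%nat)%C ->
  a 2%nat = (w1 * b 2%nat + w2 * b 1%nat + w3 * b 0%nat)%C ->
  Cmod w1 <= 1 /\ Cmod w2 <= 1 - Cmod w1 ^ 2 /\
  (1 + Cmod w1) * Cmod w3 <= (1 + Cmod w1) * (1 - Cmod w1 ^ 2) - Cmod w2 ^ 2.
Proof.
  intros HA HB HB0 Hle E0 E1 E2.
  assert (D0 : in_disk (RtoC 0)) by (unfold in_disk; rewrite Cmod_0; lra).
  set (p := Cmod (b 0%nat)).
  assert (Hp : 0 < p).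
  { apply Cmod_gt_0. rewrite <- (expands_at_0 _ _ HB). now apply HB0. }
  assert (Hx : Cmod w1 <= 1).
  { pose proof (Hle _ D0) as H. rewrite (expands_at_0 _ _ HA), (expands_at_0 _ _ HB), E0, Cmod_mult in H.
    fold p in H. nra. }
  pose proof (Cmod_ge_0 w1) as Hx0. pose proof (Cmod_ge_0 w2) as Hy0.
  split; [exact Hx|]. split.
  - pose proof (schwarz_pick_quotient a b A B HA HB HB0 Hle) as H.
    rewrite E0, E1 in H.
    replace (b 0%nat * (w1 * b 1%nat + w2 * b 0%nat) - w1 * b 0%nat * b 1%nat)%C
      with (w2 * (b 0%nat * b 0%nat))%C in H by ring.
    rewrite !Cmod_mult in H. fold p in H.
    apply (Rmult_le_reg_r (p * p)); nra.
  - set (x := Cmod w1) in *. set (y := Cmod w2) in *. set (v := Cmod w3).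
    enough (K : (1 + 1 * x) * (1 * v) - ((1 + 1 * x) * (1 - 1 * 1 * x ^ 2) - 1 * 1 * y ^ 2) <= 0)
      by lra.
    apply (continuity_le_at_1 (fun t =>
      (1 + t * x) * (t * v) - ((1 + t * x) * (1 - t * t * x ^ 2) - t * t * y ^ 2))).
    { reg. }
    intros t Ht.
    destruct (schur_step _ b (fun z => RtoC t * A z)%C B t (expands_scal t a A HA) HB HB0
       ltac:(lra) (scaled_bound A B t Ht Hle)) as [A1 [B1 [HA1 [HB1 [Hnz Hle1]]]]].
    pose proof (schwarz_pick_quotient _ _ A1 B1 HA1 HB1 Hnz Hle1) as H. cbv beta in H.
    rewrite E0, E1, E2 in H.
    set (T := 1 - t * t * x ^ 2).
    assert (Hxx : (w1 * Cconj w1)%C = RtoC (x ^ 2)) by (unfold x; now rewrite Cmod2_conj).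
    assert (Hpp : (b 0%nat * Cconj (b 0%nat))%C = RtoC (p ^ 2)) by (unfold p; now rewrite Cmod2_conj).
    assert (Hd0 : (Cconj (b 0%nat) * b 0%nat - Cconj (RtoC t * (w1 * b 0%nat)) * (RtoC t * (w1 * b 0%nat)))%C
       = RtoC (p ^ 2 * T)).
    { rewrite !Cmult_conj.
      replace (Cconj (RtoC t)) with (RtoC t) by (apply injective_projections; cbn; ring).
      replace (Cconj (b 0%nat) * b 0%nat - RtoC t * (Cconj w1 * Cconj (b 0%nat)) * (RtoC t * (w1 * b 0%nat)))%C
        with ((b 0%nat * Cconj (b 0%nat)) * (1 - RtoC t * RtoC t * (w1 * Cconj w1)))%C by ring.
      rewrite Hxx, Hpp. unfold T. now rewrite RtoC_mult, RtoC_minus, !RtoC_mult. }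
    rewrite Hd0 in H.
    (* The terms with b_1 and b_2 cancel, leaving only w1, w2, w3 and powers of b_0. *)
    match type of H with Cmod ?u <= _ =>
      replace u with (RtoC t * (b 0%nat * b 0%nat * RtoC (p ^ 2))
          * (w3 * RtoC T + RtoC t * RtoC t * Cconj w1 * (w2 * w2)))%C in H end.
    2:{ rewrite !Cmult_conj.
      replace (Cconj (RtoC t)) with (RtoC t) by (apply injective_projections; cbn; ring).
      rewrite RtoC_mult. unfold T. rewrite RtoC_minus, !RtoC_mult, <- Hxx, <- Hpp. ring. }
    replace (b 0%nat * (RtoC t * (w1 * b 1%nat + w2 * b 0%nat)) - RtoC t * (w1 * b 0%nat) * b 1%nat)%C
      with (RtoC t * w2 * (b 0%nat * b 0%nat))%C in H by ring.
    rewrite !Cmod_mult, !Cmod_R, !(Rabs_pos_eq t), !(Rabs_pos_eq (p ^ 2)) in H by nra.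
    fold p y in H.
    assert (Htx : t * x < 1) by nra.
    assert (HT : T = (1 - t * x) * (1 + t * x)) by (unfold T; ring).
    assert (Htx0 : 0 <= t * x) by nra.
    assert (HT0 : 0 < T) by (rewrite HT; nra).
    rewrite (Rabs_pos_eq (p ^ 2 * T)) in H by nra.
    set (Z := Cmod (w3 * RtoC T + RtoC t * RtoC t * Cconj w1 * (w2 * w2))%C) in *.
    assert (HZ : v * T - t * t * x * (y * y) <= Z).
    { assert (v * T <= Z + t * t * x * (y * y)); [|lra].
      unfold v. rewrite <- (Rabs_pos_eq T) at 1 by lra. rewrite <- Cmod_R, <- Cmod_mult.
      replace (w3 * RtoC T)%C with ((w3 * RtoC T + RtoC t * RtoC t * Cconj w1 * (w2 * w2))
         + - (RtoC t * RtoC t * Cconj w1 * (w2 * w2)))%C by ring.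
      eapply Rle_trans; [apply Cmod_triangle|]. fold Z. rewrite Cmod_opp, !Cmod_mult, Cmod_conj, Cmod_R.
      rewrite (Rabs_pos_eq t) by lra. fold x y. lra. }
    assert (H4 : 0 < p ^ 4) by (apply pow_lt; lra).
    (* Schwarz-Pick after removal of the common factor p^4. With [HZ] and T = (1 - t x)(1 + t x),
       the factor 1 - t x then cancels too. *)
    assert (HZ2 : t * Z <= T * T - t * t * (y * y)).
    { apply (Rmult_le_reg_l (p ^ 4)); [exact H4|]. nra. }
    apply (Rmult_le_reg_l (1 - t * x)); [lra|].
    assert (HZ3 : t * (v * T - t * t * x * (y * y)) <= t * Z) by (apply Rmult_le_compat_l; lra).
    fold T. rewrite HT in *.
    ring_simplify. ring_simplify in HZ2. ring_simplify in HZ3. nra.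
Qed.

Lemma hankel_functional_bound (w1 w2 w3 : C) (k : R) :
  Rabs k <= 1 -> Cmod w1 <= 1 -> Cmod w2 <= 1 - Cmod w1 ^ 2 ->
  (1 + Cmod w1) * Cmod w3 <= (1 + Cmod w1) * (1 - Cmod w1 ^ 2) - Cmod w2 ^ 2 ->
  Cmod (RtoC (4 / 3) * (w1 * w3) + RtoC (2 / 3) * (w1 * w1 * w2) - w2 * w2
        + RtoC k * (w1 * w1 * w1 * w1)) <= 1.
Proof.
  intros Hk Hx Hy Hv.
  pose proof (Cmod_ge_0 w1) as Hx0. pose proof (Cmod_ge_0 w2) as Hy0. pose proof (Cmod_ge_0 w3) as Hv0.
  apply Rle_trans with (4 / 3 * (Cmod w1 * Cmod w3) + 2 / 3 * (Cmod w1 * Cmod w1 * Cmod w2)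
     + Cmod w2 * Cmod w2 + 1 * (Cmod w1 * Cmod w1 * Cmod w1 * Cmod w1)).
  - eapply Rle_trans; [apply Cmod_triangle|].
    apply Rplus_le_compat.
    + eapply Rle_trans; [apply Cmod_triangle|]. rewrite Cmod_opp.
      apply Rplus_le_compat.
      * eapply Rle_trans; [apply Cmod_triangle|].
        rewrite !Cmod_mult, !Cmod_R, !Rabs_pos_eq by lra. lra.
      * rewrite Cmod_mult. lra.
    + rewrite !Cmod_mult, Cmod_R. apply Rmult_le_compat_r; [|exact Hk].
      repeat apply Rmult_le_pos; exact Hx0.
  - set (x := Cmod w1) in *. set (y := Cmod w2) in *. set (v := Cmod w3) in *.
    apply (Rmult_le_reg_l (1 + x)); [lra|].
    assert (H1 : 4 / 3 * x * ((1 + x) * v) <= 4 / 3 * x * ((1 + x) * (1 - x ^ 2) - y ^ 2))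
      by (apply Rmult_le_compat_l; lra).
    (* Eliminating v leaves y^2 with coefficient (1 + x) - 4x/3 = 1 - x/3 > 0. At y = 1 - x^2 the
       total, divided by 1 + x, is (1 - x^2)(1 + x^2) + x^4 = 1. *)
    assert (H2 : (1 - x / 3) * (y * y) <= (1 - x / 3) * ((1 - x ^ 2) * (1 - x ^ 2))).
    { apply Rmult_le_compat_l; [lra|]. apply Rmult_le_compat; lra. }
    assert (H3 : (1 + x) * (x * x) * y <= (1 + x) * (x * x) * (1 - x ^ 2)).
    { apply Rmult_le_compat_l; [|lra]. apply Rmult_le_pos; nra. }
    nra.
Qed.

(** * The upper bound *)

Lemma Cmod_lt_of_sqr (x y : C) : Cmod x ^ 2 < Cmod y ^ 2 -> Cmod x < Cmod y.
Proof. pose proof (Cmod_ge_0 x). pose proof (Cmod_ge_0 y). intros. nra. Qed.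

(* Re p > alpha says that p is closer to 1 than to its mirror image 2 alpha - 1. *)
Lemma half_plane_reflection (alpha : R) (p : C) :
  alpha < 1 -> alpha < Re p -> Cmod (p - 1) < Cmod (p + (1 - 2 * alpha)).
Proof.
  intros Ha Hp. apply Cmod_lt_of_sqr. rewrite !Cmod_sqr. destruct p as [x y]. cbn in *. nra.
Qed.

Lemma hankel22_starlike_le (alpha : R) (f : C -> C) (a : nat -> C) :
  0 <= alpha < 1 -> starlike_of_order alpha f -> normalized_expansion f a ->
  hankel22 a <= (1 - alpha) ^ 2.
Proof.
  intros Ha [_ [_ [Hnz Hre]]] [Ha0 [Ha1 Hf]].
  change (expands a f) in Hf.
  pose proof (expands_z_derive a f Hf) as Hzf.
  (* The coefficients of z f' - f at orders 0 and 1 vanish, so z f' - f = z^2 A, while z f' + (1 - 2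
     alpha) f = z B. *)
  destruct (expands_decr _ _ (expands_plus _ _ _ _ Hzf (expands_scal (- (1))%C _ _ Hf))) as [A' [HA' EA']].
  destruct (expands_decr _ _ HA') as [A [HA EA]].
  destruct (expands_decr _ _ (expands_plus _ _ _ _ Hzf (expands_scal (1 - 2 * alpha)%C _ _ Hf))) as [B [HB EB]].
  cbv beta in HA, EA, HB, EB, EA'.
  rewrite Ha0 in EA', EB. rewrite Ha1 in EA.
  assert (Hlt : forall z, in_disk z -> Cmod (z * A z) < Cmod (B z)).
  { intros z Hz. destruct (Ceq_dec z 0) as [->|Hz0].
    - rewrite Cmult_0_l, Cmod_0, (expands_at_0 _ _ HB), Ha1.
      replace (INR 1 * 1 + (1 - 2 * alpha) * 1)%C with (RtoC (2 - 2 * alpha))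
        by (apply injective_projections; cbn; ring).
      rewrite Cmod_R, Rabs_pos_eq; lra.
    - specialize (Hre z Hz). specialize (Hnz z Hz Hz0). unfold starlike_quotient in Hre.
      destruct (Ceq_dec z 0) as [|_]; [contradiction|].
      apply (half_plane_reflection alpha _ (proj2 Ha)) in Hre.
      apply Cmod_gt_0 in Hz0 as Hzp. apply Cmod_gt_0 in Hnz as Hfp.
      apply (Rmult_lt_reg_l (Cmod z)); [exact Hzp|]. rewrite <- !Cmod_mult.
      replace (z * (z * A z))%C with ((z * C_derive f z / f z - 1) * f z)%C.
      2:{ transitivity (z * C_derive f z + - (1) * f z)%C; [field; exact Hnz|].
          rewrite (EA' z Hz), (EA z Hz). cbn [INR]. ring. }
      replace (z * B z)%C with ((z * C_derive f z / f z + (1 - 2 * alpha)) * f z)%C.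
      2:{ transitivity (z * C_derive f z + (1 - 2 * alpha) * f z)%C; [field; exact Hnz|].
          rewrite (EB z Hz). ring. }
      rewrite !(Cmod_mult _ (f z)). now apply Rmult_lt_compat_r. }
  assert (HBnz : forall z, in_disk z -> B z <> RtoC 0).
  { intros z Hz. apply Cmod_gt_0. eapply Rle_lt_trans; [apply Cmod_ge_0|now apply Hlt]. }
  assert (HAB : forall z, in_disk z -> Cmod (A z) <= Cmod (B z)).
  { apply (schwarz_quotient _ _ A B HA HB HBnz). intros z Hz. left. now apply Hlt. }
  set (be := 1 - alpha). assert (Hbe : 0 < be <= 1) by (unfold be; lra).
  assert (Hbc : RtoC be <> 0%C) by (intros E; apply RtoC_inj in E; lra).
  assert (H2c : RtoC 2 <> 0%C) by (intros E; apply RtoC_inj in E; lra).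
  assert (H3c : RtoC 3 <> 0%C) by (intros E; apply RtoC_inj in E; lra).
  (* The three unknowns solve A = (w1 + w2 z + w3 z^2 + ...) B up to order 2, where A has
     coefficients (n + 1) a_(n+2) and B has (n + 2 be) a_(n+1). *)
  set (w1 := (a 2%nat / (2 * be))%C).
  set (w2 := ((2 * a 3%nat - (1 + 2 * be) * a 2%nat * w1) / (2 * be))%C).
  set (w3 := ((3 * a 4%nat - (1 + 2 * be) * a 2%nat * w2 - (2 + 2 * be) * a 3%nat * w1) / (2 * be))%C).
  assert (Ealpha : RtoC alpha = (1 - be)%C) by (unfold be; rewrite RtoC_minus; ring).
  assert (I2 : RtoC (INR 2) = 2%C) by reflexivity.
  assert (I3 : RtoC (INR 3) = 3%C) by (f_equal; cbn; ring).
  assert (I4 : RtoC (INR 4) = 4%C) by (f_equal; cbn; ring).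
  destruct (schwarz_coefficients _ _ A B w1 w2 w3 HA HB HBnz HAB) as [H1 [H2 H3]].
  - cbv beta. rewrite Ha1, I2, Ealpha. unfold w1. change (RtoC (INR 1)) with (RtoC 1). field. auto.
  - cbv beta. rewrite Ha1, I2, I3, Ealpha. unfold w2, w1. change (RtoC (INR 1)) with (RtoC 1). field. auto.
  - cbv beta. rewrite Ha1, I2, I3, I4, Ealpha. unfold w3. change (RtoC (INR 1)) with (RtoC 1).
    field. auto.
  - assert (Hk : Rabs ((1 - 4 * be ^ 2) / 3) <= 1) by (apply Rabs_le_between; nra).
    pose proof (hankel_functional_bound w1 w2 w3 _ Hk H1 H2 H3) as H.
    unfold hankel22.
    match type of H with Cmod ?u <= 1 =>
      replace (a 2%nat * a 4%nat - a 3%nat * a 3%nat)%C with (RtoC be * RtoC be * u)%C end.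
    + rewrite !Cmod_mult, Cmod_R, Rabs_pos_eq by lra. fold be. nra.
    + assert (E2 : a 2%nat = (2 * be * w1)%C) by (unfold w1; field; auto).
      assert (E3 : a 3%nat = (((1 + 2 * be) * a 2%nat * w1 + 2 * be * w2) / 2)%C)
        by (unfold w2; field; auto).
      assert (E4 : a 4%nat = (((1 + 2 * be) * a 2%nat * w2 + (2 + 2 * be) * a 3%nat * w1 + 2 * be * w3) / 3)%C)
        by (unfold w3; field; auto).
      rewrite E4, E3, E2.
      replace (RtoC ((1 - 4 * be ^ 2) / 3)) with ((1 - 4 * (be * be)) / 3)%C
        by (apply injective_projections; cbn; field).
      rewrite !RtoC_div by lra. field.
Qed.

(** * Sharpness *)

(* Taylor coefficients of z (1 - z^2)^(-beta). *)
Fixpoint extremal_coef (beta : R) (n : nat) : R :=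
  match n with
  | O => 0
  | S O => 1
  | S (S m) => (INR m - 1 + 2 * beta) / (INR m + 1) * extremal_coef beta m
  end.

Lemma extremal_coef_bound (beta : R) (n : nat) :
  0 <= beta <= 1 -> Rabs (extremal_coef beta n) <= 1.
Proof.
  intros Hb.
  assert (H : Rabs (extremal_coef beta n) <= 1 /\ Rabs (extremal_coef beta (S n)) <= 1);
    [|apply H].
  induction n as [|n [IH1 IH2]].
  - cbn. rewrite Rabs_R0, Rabs_R1. lra.
  - split; [exact IH2|].
    change (extremal_coef beta (S (S n)))
      with ((INR n - 1 + 2 * beta) / (INR n + 1) * extremal_coef beta n).
    (* At index 0 the factor may be negative, but it multiplies the coefficient 0; from index 1 on
       it lies in [0, 1]. *)
    rewrite Rabs_mult. destruct n as [|n].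
    + cbn [extremal_coef]. rewrite Rabs_R0. lra.
    + pose proof (pos_INR n) as Hn. rewrite S_INR.
      assert (0 <= (INR n + 1 - 1 + 2 * beta) / (INR n + 1 + 1)) by (apply Rdiv_le_0_compat; lra).
      assert ((INR n + 1 - 1 + 2 * beta) / (INR n + 1 + 1) <= 1)
        by (apply <- Rle_div_l; lra).
      rewrite (Rabs_pos_eq (_ / _)) by assumption.
      pose proof (Rabs_pos (extremal_coef beta (S n))). nra.
Qed.

(** The recursion (m + 1) c_(m+2) = (m - 1 + 2 beta) c_m is this equation read off at order m + 2;
    it replaces the closed form of [f], so no complex power is needed. *)
Lemma extremal_ode (beta : R) (f : C -> C) (z : C) :
  expands (fun n => RtoC (extremal_coef beta n)) f -> in_disk z ->
  (z * C_derive f z * (1 - z * z) = f z * (1 + (2 * beta - 1) * (z * z)))%C.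
Proof.
  intros Hf Hz.
  pose proof (expands_z_derive _ _ Hf) as HD.
  pose proof (expands_shift _ _ (expands_shift _ _ HD)) as HD2.
  pose proof (expands_shift _ _ (expands_shift _ _ Hf)) as Hf2.
  pose proof (expands_plus _ _ _ _ (expands_plus _ _ _ _ HD (expands_scal (- (1))%C _ _ HD2))
    (expands_plus _ _ _ _ (expands_scal (- (1))%C _ _ Hf) (expands_scal (- (2 * beta - 1))%C _ _ Hf2))) as H.
  assert (E : (z * C_derive f z + - (1) * (z * (z * (z * C_derive f z)))
      + (- (1) * f z + - (2 * beta - 1) * (z * (z * f z))) = 0)%C).
  { refine (expands_unique _ _ (fun _ => RtoC 0) z H _ Hz).
    refine (expands_ext _ _ _ _ _ (fun z _ => eq_refl) (expands_const 0)).
    intros [|[|n]].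
    - cbn. apply injective_projections; cbn; ring.
    - cbn. apply injective_projections; cbn; ring.
    - change (extremal_coef beta (S (S n)))
        with ((INR n - 1 + 2 * beta) / (INR n + 1) * extremal_coef beta n).
      rewrite !S_INR. pose proof (pos_INR n).
      apply injective_projections; cbn; field; lra. }
  replace (z * C_derive f z * (1 - z * z))%C with
    ((z * C_derive f z + - (1) * (z * (z * (z * C_derive f z)))
      + (- (1) * f z + - (2 * beta - 1) * (z * (z * f z)))) + f z * (1 + (2 * beta - 1) * (z * z)))%C by ring.
  rewrite E. ring.
Qed.

Lemma one_minus_sqr_neq_0 (z : C) : in_disk z -> (1 - z * z)%C <> RtoC 0.
Proof.
  unfold in_disk. intros Hz E. apply (f_equal Cmod) in E. rewrite Cmod_0 in E.
  assert (H : Cmod 1 <= Cmod (1 - z * z) + Cmod (z * z)).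
  { replace (RtoC 1) with ((1 - z * z) + z * z)%C at 1 by ring. apply Cmod_triangle. }
  rewrite Cmod_1, E, Cmod_mult in H. pose proof (Cmod_ge_0 z). nra.
Qed.

(** With w = z^2 the quotient is 1 + 2 beta w/(1 - w), and Re (w/(1 - w)) > -1/2 in the disk. *)
Lemma extremal_quotient_re (beta : R) (z : C) :
  0 < beta -> in_disk z ->
  1 - beta < Re ((1 + (2 * beta - 1) * (z * z)) / (1 - z * z))%C.
Proof.
  intros Hb Hz. pose proof (one_minus_sqr_neq_0 z Hz) as Hnz.
  assert (Hw : Cmod (z * z) ^ 2 < 1).
  { rewrite Cmod_mult. unfold in_disk in Hz. pose proof (Cmod_ge_0 z).
    assert (Cmod z * Cmod z < 1) by nra.
    assert (0 <= Cmod z * Cmod z) by nra. nra. }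
  set (w := (z * z)%C) in *. clearbody w.
  pose proof (proj1 (Cmod_gt_0 _) Hnz) as Hp.
  assert (Hd : 0 < Cmod (1 - w) ^ 2) by (apply pow_lt; exact Hp).
  rewrite Cmod_sqr in Hd, Hw.
  destruct w as [x y]. cbn in Hd, Hw |- *.
  match goal with |- _ < ?e => replace e with
    (1 + 2 * beta * (x - (x * x + y * y)) / ((1 - x) * (1 - x) + y * y)) end.
  2:{ field. nra. }
  assert (Hd' : 0 < (1 - x) * (1 - x) + y * y) by nra.
  enough (- beta < 2 * beta * (x - (x * x + y * y)) / ((1 - x) * (1 - x) + y * y)) by lra.
  apply -> Rlt_div_r; [|exact Hd']. nra.
Qed.

(** The factor [l] selects a real component: l = 1 gives the real part of f along the ray, l = -i
    the imaginary part. *)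
Lemma radial_derivative (a : nat -> C) (f : C -> C) (l z0 : C) (t : R) :
  expands a f -> in_disk (RtoC t * z0)%C ->
  derivable_pt_lim (fun s => Re (l * f (RtoC s * z0)%C)) t
    (Re (l * (z0 * C_derive f (RtoC t * z0)%C))).
Proof.
  intros Hf Ht.
  destruct (expands_is_derive a f _ Hf Ht) as [_ [_ [K [d [HK [Hd Herr]]]]]].
  set (m := Cmod z0). assert (Hm : 0 <= m) by apply Cmod_ge_0.
  set (L := Cmod l * K * (m * m)).
  assert (HL : 0 <= L) by (unfold L; repeat apply Rmult_le_pos; trivial; apply Cmod_ge_0).
  intros eps Heps.
  set (dl := Rmin (d / (m + 1)) (eps / (L + 1))).
  assert (Hd1 : 0 < d / (m + 1)) by (apply Rdiv_lt_0_compat; lra).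
  assert (Hd2 : 0 < eps / (L + 1)) by (apply Rdiv_lt_0_compat; lra).
  assert (Hdl : 0 < dl) by now apply Rmin_pos.
  exists (mkposreal _ Hdl). intros h Hh0 Hh. cbn in Hh.
  assert (Hh1 : Rabs h < d / (m + 1)) by (eapply Rlt_le_trans; [exact Hh|apply Rmin_l]).
  assert (Hh2 : Rabs h < eps / (L + 1)) by (eapply Rlt_le_trans; [exact Hh|apply Rmin_r]).
  apply Rlt_div_r in Hh1; [|lra]. apply Rlt_div_r in Hh2; [|lra].
  pose proof (Rabs_pos_lt h Hh0) as Hhp.
  specialize (Herr (RtoC (t + h) * z0)%C).
  replace (RtoC (t + h) * z0 - RtoC t * z0)%C with (RtoC h * z0)%C in Herr
    by (rewrite RtoC_plus; ring).
  rewrite Cmod_mult, Cmod_R in Herr. fold m in Herr.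
  specialize (Herr ltac:(nra)).
  set (D := C_derive f (RtoC t * z0)%C) in *.
  set (X := (f (RtoC (t + h) * z0) - f (RtoC t * z0) - RtoC h * z0 * D)%C) in *.
  replace ((Re (l * f (RtoC (t + h) * z0)%C) - Re (l * f (RtoC t * z0)%C)) / h - Re (l * (z0 * D)))
    with (Re (l * X) / h).
  2:{ unfold X. destruct l, (f (RtoC (t + h) * z0)%C), (f (RtoC t * z0)%C), z0, D. cbn. field. exact Hh0. }
  unfold Rdiv. rewrite Rabs_mult, Rabs_inv.
  apply (Rmult_lt_reg_r (Rabs h)); [exact Hhp|].
  rewrite Rmult_assoc, Rinv_l, Rmult_1_r by lra.
  eapply Rle_lt_trans; [apply re_le_Cmod|]. rewrite Cmod_mult.
  apply Rle_lt_trans with (L * (Rabs h * Rabs h)).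
  - unfold L. replace (Cmod l * K * (m * m) * (Rabs h * Rabs h))
      with (Cmod l * (K * (Rabs h * m * (Rabs h * m)))) by ring.
    apply Rmult_le_compat_l; [apply Cmod_ge_0|exact Herr].
  - nra.
Qed.

(* Re (z f'/f) >= 0 makes |f| nondecreasing along rays; a zero would force f to
   vanish on a whole segment from the origin, contradicting f'(0) = 1. *)
Lemma nonvanishing_of_ode (a : nat -> C) (f c : C -> C) (z0 : C) :
  expands a f -> a 0%nat = RtoC 0 -> a 1%nat = RtoC 1 ->
  (forall z, in_disk z -> z * C_derive f z = f z * c z)%C ->
  (forall z, in_disk z -> 0 <= Re (c z)) ->
  in_disk z0 -> z0 <> RtoC 0 -> f z0 <> RtoC 0.
Proof.
  intros Hf Ha0 Ha1 Hode Hc Hz0 Hne Hzero.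
  unfold in_disk in Hz0. pose proof (proj1 (Cmod_gt_0 z0) Hne) as Hm.
  assert (Hray : forall t, 0 <= t <= 1 -> in_disk (RtoC t * z0)%C).
  { intros t Ht. unfold in_disk. rewrite Cmod_mult, Cmod_R, Rabs_pos_eq by lra. nra. }
  assert (Hvan : forall t, 0 < t < 1 -> f (RtoC t * z0)%C = RtoC 0).
  { intros t Ht.
    set (re := fun s => Re (1 * f (RtoC s * z0)%C)).
    set (im := fun s => Re (- Ci * f (RtoC s * z0)%C)).
    set (re' := fun s => Re (1 * (z0 * C_derive f (RtoC s * z0)%C))).
    set (im' := fun s => Re (- Ci * (z0 * C_derive f (RtoC s * z0)%C))).
    set (N := fun s => re s * re s + im s * im s).
    (* [N] is |f|^2 along the ray. Its derivative at s satisfies s N'(s) = 2 Re (c) |f|^2 >= 0, so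
       N(t) <= N(1) = 0. *)
    destruct (MVT_cor2 N (fun s => (re' s * re s + re s * re' s) + (im' s * im s + im s * im' s)) t 1)
      as [s [Hs Hst]]; [lra| |].
    { intros s Hs. assert (Hd : in_disk (RtoC s * z0)%C) by (apply Hray; lra).
      pose proof (radial_derivative a f 1 z0 s Hf Hd) as H1.
      pose proof (radial_derivative a f (- Ci) z0 s Hf Hd) as H2.
      exact (derivable_pt_lim_plus _ _ _ _ _
        (derivable_pt_lim_mult _ _ _ _ _ H1 H1) (derivable_pt_lim_mult _ _ _ _ _ H2 H2)). }
    assert (HN : forall s, N s = Cmod (f (RtoC s * z0)%C) ^ 2).
    { intros x. unfold N, re, im. rewrite Cmod_sqr. destruct (f (RtoC x * z0)%C). cbn. ring. }
    assert (HN1 : N 1 = 0).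
    { rewrite HN. replace (RtoC 1 * z0)%C with z0 by ring. rewrite Hzero, Cmod_0. ring. }
    assert (Hpos : 0 <= (re' s * re s + re s * re' s) + (im' s * im s + im s * im' s)).
    { assert (Hd : in_disk (RtoC s * z0)%C) by (apply Hray; lra).
      pose proof (Hode _ Hd) as E. pose proof (Hc _ Hd) as HR.
      apply (Rmult_le_reg_l s); [lra|]. rewrite Rmult_0_r.
      replace (s * ((re' s * re s + re s * re' s) + (im' s * im s + im s * im' s)))
        with (2 * (Re (c (RtoC s * z0)%C) * Cmod (f (RtoC s * z0)%C) ^ 2)).
      { apply Rmult_le_pos; [lra|]. apply Rmult_le_pos; [exact HR|apply pow2_ge_0]. }
      rewrite Cmod_sqr. unfold re, im, re', im'.
      set (F := f (RtoC s * z0)%C) in *. set (D := C_derive f (RtoC s * z0)%C) in *.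
      set (k := c (RtoC s * z0)%C) in *. clearbody F D k.
      pose proof (f_equal Re E) as E1. pose proof (f_equal Im E) as E2.
      destruct F as [F1 F2], D as [D1 D2], k as [k1 k2], z0 as [x y].
      cbn in E1, E2 |- *. ring_simplify in E1. ring_simplify in E2.
      transitivity (2 * (F1 * (F1 * k1 - F2 * k2) + F2 * (F1 * k2 + F2 * k1))); [ring|].
      replace (F1 * k1 - F2 * k2) with (s * x * D1 - s * y * D2) by lra.
      replace (F1 * k2 + F2 * k1) with (s * x * D2 + s * y * D1) by lra.
      ring. }
    assert (N t <= 0) by nra.
    rewrite HN in H. apply Cmod_eq_0. pose proof (Cmod_ge_0 (f (RtoC t * z0)%C)). nra. }
  (* Write f = z (1 + z h). Close to the origin |z h| < 1, so f cannot vanish at a nonzero point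
     there; [e] and [t] pick such a point on the ray. *)
  destruct (expands_decr _ _ Hf) as [g [Hg Eg]].
  destruct (expands_decr _ _ Hg) as [h [Hh Eh]].
  assert (D0 : in_disk (RtoC 0)) by (unfold in_disk; rewrite Cmod_0; lra).
  destruct (expands_locally_bounded _ _ _ Hh D0) as [K [d [HK [Hd Hbd]]]].
  set (e := Rmin d (1 / (K + 1))).
  assert (He : 0 < e) by (apply Rmin_pos; [exact Hd|apply Rdiv_lt_0_compat; lra]).
  pose proof (Rmin_l d (1 / (K + 1))). pose proof (Rmin_r d (1 / (K + 1))).
  set (t := Rmin 1 e / 2).
  assert (Ht0 : 0 < Rmin 1 e) by (apply Rmin_pos; lra).
  pose proof (Rmin_l 1 e). pose proof (Rmin_r 1 e).
  assert (Ht : 0 < t < 1) by (unfold t; lra).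
  assert (Hte : t < e) by (unfold t; lra).
  set (z := (RtoC t * z0)%C).
  assert (Hzm : Cmod z < e).
  { unfold z. rewrite Cmod_mult, Cmod_R, Rabs_pos_eq by lra. nra. }
  assert (Hzd : in_disk z) by (apply Hray; lra).
  destruct (Hbd z) as [_ HhK].
  { replace (z - 0)%C with z by ring. fold e in H. lra. }
  pose proof (Hvan t Ht) as Hv. fold z in Hv.
  rewrite (Eg z Hzd), (Eh z Hzd), Ha0, Ha1, Cplus_0_l in Hv.
  assert (Hznz : z <> RtoC 0).
  { apply Cmod_gt_0. unfold z. rewrite Cmod_mult, Cmod_R, Rabs_pos_eq by lra. nra. }
  assert (Hone : (1 + z * h z)%C = RtoC 0).
  { destruct (Ceq_dec (1 + z * h z)%C 0) as [|Hn]; [assumption|].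
    exfalso. exact (Cmult_neq_0 _ _ Hznz Hn Hv). }
  assert (E : Cmod (z * h z) = 1).
  { replace (z * h z)%C with ((1 + z * h z) - 1)%C by ring. rewrite Hone.
    replace (0 - 1)%C with (- (1))%C by ring. now rewrite Cmod_opp, Cmod_1. }
  rewrite Cmod_mult in E.
  assert (Hz1 : Cmod z < 1 / (K + 1)) by (unfold e in Hzm; lra).
  apply Rlt_div_r in Hz1; [|lra].
  pose proof (Cmod_ge_0 z). nra.
Qed.

Lemma hankel22_sharp (alpha : R) :
  0 <= alpha < 1 ->
  exists (f : C -> C) (a : nat -> C),
    starlike_of_order alpha f /\ normalized_expansion f a /\
    hankel22 a = (1 - alpha) ^ 2.
Proof.
  intros Ha. set (beta := 1 - alpha). assert (Hb : 0 < beta <= 1) by (unfold beta; lra).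
  set (a := fun n => RtoC (extremal_coef beta n)).
  destruct (expands_exists a) as [f Hf].
  { intros rho Hr. exists 1. intros n. unfold a. rewrite Cmod_R.
    pose proof (extremal_coef_bound beta n ltac:(lra)) as H.
    assert (0 <= rho ^ n) by (apply pow_le; lra).
    assert (rho ^ n <= 1) by (rewrite <- (pow1 n); apply pow_incr; lra).
    pose proof (Rabs_pos (extremal_coef beta n)). nra. }
  (* This is z f'/f as dictated by the differential equation. *)
  set (c := fun z => ((1 + (2 * beta - 1) * (z * z)) / (1 - z * z))%C).
  assert (Hode : forall z, in_disk z -> (z * C_derive f z = f z * c z)%C).
  { intros z Hz. pose proof (one_minus_sqr_neq_0 z Hz) as Hn.
    pose proof (extremal_ode beta f z Hf Hz) as E. unfold c.
    replace (z * C_derive f z)%C with (z * C_derive f z * (1 - z * z) / (1 - z * z))%C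
      by (field; exact Hn).
    rewrite E. unfold Cdiv. ring. }
  assert (Hc : forall z, in_disk z -> alpha < Re (c z)).
  { intros z Hz. replace alpha with (1 - beta) by (unfold beta; ring).
    apply extremal_quotient_re; [lra|exact Hz]. }
  assert (Hnz : forall z, in_disk z -> z <> RtoC 0 -> f z <> RtoC 0).
  { intros z. apply (nonvanishing_of_ode a f c z Hf eq_refl eq_refl Hode).
    intros w Hw. specialize (Hc w Hw). lra. }
  assert (Hnorm : normalized_expansion f a) by (split; [|split]; [reflexivity|reflexivity|exact Hf]).
  exists f, a. split; [|split; [exact Hnorm|]].
  - split; [|split; [now exists a|split; [exact Hnz|]]].
    + intros z Hz. exists (C_derive f z). now apply (expands_is_derive a).
    + intros z Hz. unfold starlike_quotient. destruct (Ceq_dec z 0) as [_|Hz0].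
      * cbn. lra.
      * rewrite (Hode z Hz). replace (f z * c z / f z)%C with (c z) by (field; now apply Hnz).
        now apply Hc.
  - unfold hankel22, a.
    (* The series is odd, so a_2 = a_4 = 0, and a_3 = beta. *)
    replace (RtoC (extremal_coef beta 2) * RtoC (extremal_coef beta 4)
      - RtoC (extremal_coef beta 3) * RtoC (extremal_coef beta 3))%C with (RtoC (- beta ^ 2)).
    + rewrite Cmod_R, Rabs_Ropp, Rabs_pos_eq; [reflexivity|apply pow2_ge_0].
    + apply injective_projections; cbn; field.
Qed.

Theorem mainTheorem1 (alpha : R) (Halpha : 0 <= alpha < 1) :
  (forall (f : C -> C) (a : nat -> C),
      starlike_of_order alpha f -> normalized_expansion f a ->
      hankel22 a <= (1 - alpha) ^ 2) /\
  (exists (f : C -> C) (a : nat -> C),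
      starlike_of_order alpha f /\ normalized_expansion f a /\
      hankel22 a = (1 - alpha) ^ 2).
Proof.
  split.
  - intros f a. now apply hankel22_starlike_le.
  - now apply hankel22_sharp.
Qed.
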